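(* The coefficients of the three term recurrence relation $xP_n^{(\lambda)}(x)=P_{n+1}^{(\lambda)}(x)+B_n^{(\lambda)}P_n^{(\lambda)}(x)+C_n^{(\lambda)}P_{n-1}^{(\lambda)}(x)$ of the monic matrix Charlier polynomials are $$C_n^{(\lambda)}=L_0^{-1}(I+A)^{n+\lambda}\mathcal D_n^{(\lambda)}(I+A^* )(\mathcal D_{n-1}^{(\lambda)})^{-1}(I+A)^{-n-\lambda+1}L_0\qquad(n\ge1)$$ and $$B_n^{(\lambda)}=aL_0^{-1}(I+A)^{n+\lambda}\Bigl((n+1)(I+A)\mathcal A_{n+\lambda+1}-n\mathcal A_{n+\lambda}(I+A)+I+A+\frac naI\Bigr)(I+A)^{-\lambda-n}L_0\qquad(n\ge0).$$
   Context: $N\ge1$, $a>0$, $\lambda\in\mathbb N_0=\{0,1,2,\dots\}$. $\mu_1,\dots,\mu_N>0$ satisfy $(\mu_j/\mu_k)^2=a^{k-j}\frac{(N-k)!}{(N-j)!}$ and $\delta_k^{(\lambda)}=(a/2)^\lambda\frac{(\lambda+k-1)!}{(k-1)!}$. $A$ is the $N\times N$ matrix whose only nonzero entries are $A_{k+1,k}=\mu_{k+1}/\mu_k=\sqrt{(N-k)/a}$, $1\le k\le N-1$; $J=\mathrm{diag}(1,\dots,N)$; $T^{(\lambda)}=\mathrm{diag}(\delta_1^{(\lambda)},\dots,\delta_N^{(\lambda)})$; $L_0$ is lower triangular with $(L_0)_{jk}=\frac{\mu_j}{\mu_k}\frac{(-a)^{j-k}}{(j-k)!}$ for $j\ge k$.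 The weight is $W^{(\lambda)}(x)=\frac{a^x}{x!}(I+A)^{x+\lambda}T^{(\lambda)}(I+A^* )^{x+\lambda}$, $x\in\mathbb N_0$; $(P_n^{(\lambda)})_n$ are its monic matrix orthogonal polynomials for $\langle P,Q\rangle^{(\lambda)}=\sum_{x=0}^\infty P(x)W^{(\lambda)}(x)Q(x)^*$ ($P_{-1}^{(\lambda)}=0$), $\mathcal H_n^{(\lambda)}=\langle P_n^{(\lambda)},P_n^{(\lambda)}\rangle^{(\lambda)}$, and $\mathcal D_n^{(\lambda)}$ is the positive definite diagonal matrix with $\mathcal H_n^{(\lambda)}=L_0^{-1}(I+A)^{n+\lambda}\mathcal D_n^{(\lambda)}(I+A^* )^{n+\lambda}(L_0^* )^{-1}$. $\mathcal A_s=((N+s)I-J)^{-1}JA^*$, i.e. the upper triangular matrix whose only nonzero entries are $(\mathcal A_s)_{j,j+1}=\frac{j}{N+s-j}\sqrt{(N-j)/a}$, $1\le j\le N-1$ (this entrywise formula is also used for $s=0$). *)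

(* Defs.v *)
From HB Require Import structures.
From mathcomp Require Import all_boot all_order all_algebra.
From mathcomp Require Import spectral complex.
From mathcomp Require Import all_classical all_reals all_analysis.
From mathcomp Require Import zify.
Set Implicit Arguments.
Unset Strict Implicit.
Unset Printing Implicit Defensive.
Import Order.TTheory GRing.Theory Num.Theory.
Import numFieldNormedType.Exports.
Local Open Scope ring_scope.
Local Open Scope complex_scope.
Local Open Scope sesquilinear_scope.

(* The complex numbers R[i], typed as a [numClosedFieldType] so that the
   canonical topology of numeric closed fields is inferred on them. *)
Definition Cplx (R : realType) : numClosedFieldType := R[i].

(* The size of the matrices is N := m.+1, so that ['M_N] is a nontrivial ring
   and ['M_N[x]] is the ring [{poly 'M_m.+1}], in which ['X] is central.
   The family mu is indexed by 1, ..., N, and the ordinal [i : 'I_m.+1] stands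
   for the row or column of number [i.+1]. *)
Section MatrixCharlier.
Variables (R : realType) (m : nat).
Local Notation C := (Cplx R).
Local Notation N := m.+1.

Definition ofR (x : R) : C := x%:C.

Definition posdefmx (M : 'M[C]_N) : Prop :=
  M ^t* = M /\ forall u : 'rV[C]_N, u != 0 -> 0 < (u *m M *m u ^t*) 0 0.

Definition evalN (P : {poly 'M[C]_N}) (x : nat) : 'M[C]_N := P.[x%:R].

Definition mx_inner (W : nat -> 'M[C]_N) (P Q : {poly 'M[C]_N}) : 'M[C]_N :=
  limn (series (fun x => evalN P x * W x * (evalN Q x) ^t*)).

Definition monic_orthogonal (W : nat -> 'M[C]_N)
    (P : nat -> {poly 'M[C]_N}) : Prop :=
  (forall n, P n \is monic /\ size (P n) = n.+1) /\
  (forall n k, n != k -> mx_inner W (P n) (P k) = 0).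

Definition three_term (P : nat -> {poly 'M[C]_N}) (B G : nat -> 'M[C]_N) :=
  forall n, 'X * P n =
    P n.+1 + (B n)%:P * P n + (G n)%:P * (if n is k.+1 then P k else 0).

Definition mu_spec (a : R) (mu : nat -> R) : Prop :=
  (forall k, (1 <= k <= N)%N -> 0 < mu k) /\
  (forall j k, (1 <= j <= N)%N -> (1 <= k <= N)%N ->
     (mu j / mu k) ^+ 2 =
       a ^ (k%:Z - j%:Z) * ((N - k)`!%:R / (N - j)`!%:R)).

Definition Amx (mu : nat -> R) : 'M[C]_N :=
  \matrix_(i, j) if i == j.+1 :> nat then ofR (mu i.+1 / mu j.+1) else 0.

Definition delta (a : R) (l k : nat) : R :=
  (a / 2) ^+ l * ((l + k - 1)`!%:R / (k - 1)`!%:R).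

Definition Tmx (a : R) (l : nat) : 'M[C]_N :=
  diag_mx (\row_i ofR (delta a l i.+1)).

Definition L0mx (a : R) (mu : nat -> R) : 'M[C]_N :=
  \matrix_(i, j) if (j <= i)%N
    then ofR (mu i.+1 / mu j.+1 * ((- a) ^+ (i - j) / (i - j)`!%:R)) else 0.

Definition weight (a : R) (mu : nat -> R) (l x : nat) : 'M[C]_N :=
  ofR (a ^+ x / x`!%:R) *:
    ((1 + Amx mu) ^+ (x + l) * Tmx a l * (1 + (Amx mu) ^t*) ^+ (x + l)).

Definition Jmx : 'M[C]_N := diag_mx (\row_i i.+1%:R).

(* The matrix calligraphic A_s; see [calAE] for its expression in
   terms of J and A, which only makes sense for s > 0. *)
Definition calA (a : R) (s : nat) : 'M[C]_N :=
  \matrix_(i, j) if j == i.+1 :> nat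
    then ofR (i.+1%:R / (N + s - i.+1)%:R * Num.sqrt ((N - i.+1)%:R / a))
    else 0.

Lemma AmxE (a : R) (mu : nat -> R) (i j : 'I_N) : mu_spec a mu ->
  Amx mu i j =
    if i == j.+1 :> nat then ofR (Num.sqrt ((N - j.+1)%:R / a)) else 0.
Proof.
move=> [mu_gt0 mu_sq]; rewrite mxE; case: eqP => // eij.
have hi : (1 <= i.+1 <= N)%N by rewrite ltn_ord.
have hj : (1 <= j.+1 <= N)%N by rewrite ltn_ord.
have h0 : 0 <= mu i.+1 / mu j.+1 by rewrite divr_ge0 // ltW // mu_gt0.
rewrite -[in LHS](ger0_norm h0) -sqrtr_sqr mu_sq // eij; congr (ofR (Num.sqrt _)).
have ltjm : (j < m)%N by rewrite -ltnS -eij.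
rewrite (_ : _ - _ = -1 :> int); last by lia.
rewrite exprN1 mulrC !subSS -(subnSK ltjm).
by rewrite factS natrM mulfK // pnatr_eq0 -lt0n fact_gt0.
Qed.

Lemma calAE (a : R) (mu : nat -> R) (s : nat) : mu_spec a mu -> (0 < s)%N ->
  calA a s = ((N + s)%:R%:M - Jmx)^-1 * Jmx * (Amx mu) ^t*.
Proof.
move=> muP s_gt0.
pose d : 'rV[C]_N := \row_i (N + s - i.+1)%:R.
have dE : (N + s)%:R%:M - Jmx = diag_mx d.
  apply/matrixP => i j; rewrite !mxE; case: eqVneq => [->|]; last first.
    by rewrite !mulr0n subr0.
  by rewrite !mulr1n natrB // (leq_trans (ltn_ord j)) ?leq_addr.
have d_unit : diag_mx d \is a GRing.unit.
  rewrite -[_ \is a _]/(diag_mx d \in unitmx) unitmxE det_diag unitfE.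
  apply/prodf_neq0 => i _; rewrite mxE pnatr_eq0 -lt0n subn_gt0.
  by rewrite (leq_ltn_trans (ltn_ord i)) // -[X in (X < _)%N]addn0 ltn_add2l.
rewrite dE -mulrA; apply: (mulrI d_unit); rewrite mulVKr //.
have conjR x : (ofR x)^*%R = ofR x.
  by apply: conj_Creal; rewrite complex_real.
have natE n : n%:R = ofR n%:R by rewrite /ofR (rmorph_nat (real_complex R)).
apply/matrixP => i j; rewrite -!mulmxE !mul_diag_mx.
have AtE : ((Amx mu) ^t*) i j = (Amx mu j i)^*%R by rewrite mxE [in LHS]mxE.
rewrite ![in LHS]mxE [RHS]mxE.
rewrite AtE (AmxE _ _ muP) !mxE; case: eqP => _; last by rewrite conjC0 !mulr0.
rewrite conjR !natE /ofR -!(rmorphM (real_complex R)) /=; congr (_ %:C).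
rewrite mulrA mulrCA mulfV ?mulr1 //.
rewrite pnatr_eq0 -lt0n subn_gt0 (leq_ltn_trans (ltn_ord i)) //.
by rewrite -[X in (X < _)%N]addn0 ltn_add2l.
Qed.

End MatrixCharlier.

(* Main.v *)
Require Import Defs.
From HB Require Import structures.
From mathcomp Require Import all_boot all_order all_algebra.
From mathcomp Require Import spectral complex.
From mathcomp Require Import all_classical all_reals all_analysis.
From mathcomp Require Import ring zify.
Set Implicit Arguments.
Unset Strict Implicit.
Unset Printing Implicit Defensive.
Import Order.TTheory GRing.Theory Num.Theory.
Import numFieldNormedType.Exports.
Local Open Scope ring_scope.
Local Open Scope sesquilinear_scope.

(** Write N for the size of the matrices, E = I + A, F = J A^T,
    H = 2J - (N + 1), G = A E^-1, and W_s for the weight of parameter s.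

    The formula for C_n is formal: pairing the recurrence with P_(n-1) gives
    C_n <P_(n-1), P_(n-1)> = <P_n, P_n>, and the factorized norms are
    invertible ([three_term_norms]); the recurrence itself exists because the
    norms are invertible ([three_term_ex]).  Comparing the coefficients of x^n
    in the recurrence gives B_n = X_n - X_(n+1), where X_n is the coefficient
    of x^(n-1) in P_n, so the matter is to find X_n.

    The relations [J, A] = A and a [A, F] = H make conjugation by powers of E
    act on J and F through polynomials in the exponent ([conj_J], [conj_F]).
    It follows that W_(s+1)(x) and W_(s+1)(x-1) are both polynomials in x,
    of degree two, times W_s(x), and that their quadratic terms agree.
    So W_s satisfies a discrete Pearson equation: the backward difference of
    W_(s+1) is a polynomial of degree one times W_s ([pearson_nabla]).

    Summation by parts then shows that the forward difference of a function
    that is W_s-orthogonal to all polynomials of degree at most k is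
    W_(s+1)-orthogonal to those of degree less than k ([orth_upto_fdiff]).
    After n - 1 differences P_n becomes a polynomial of degree one which is
    orthogonal to the constants for W_(l+n-1).  Differences act on the top
    two coefficients in a known way, so X_n is expressed through the matrix
    B_0(s) = M_1 M_0^-1, with s = l + n - 1, where M_0 and M_1 are the first
    two moments of W_s ([subleading]); M_0 is invertible because every W_s(x)
    is positive definite ([moment0_unit]).  This yields
    B_n = (n+1) B_0(l+n) - n B_0(l+n-1) + n ([three_term_telescope]).

    Finally, summing the Pearson equation over all x gives a linear relation
    alpha M_1 + beta M_0 = 0, that is, alpha B_0(s) = - beta.  As L0 is
    exp(-aA), conjugation by L0^-1 E^(s+1) turns alpha into the diagonal
    matrix J - (N+s+1) ([alpha_conj]), whose inverse is the one that enters
    the definition of the matrix calA; this gives B_0(s) in closed form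
    ([alpha_B0]). *)

(** * Linear identities between matrices *)

Section Algebra.
Variables (K : fieldType) (m : nat).
Implicit Types X Y : 'M[K]_m.+1.

Lemma mx_entryD X Y i j : (X + Y) i j = X i j + Y i j.
Proof. by rewrite mxE. Qed.
Lemma mx_entryN X i j : (- X) i j = - X i j.
Proof. by rewrite mxE. Qed.
Lemma mx_entryZ c X i j : (c *: X) i j = c * X i j.
Proof. by rewrite mxE. Qed.
Definition mxlin := (mx_entryD, mx_entryN, mx_entryZ).
End Algebra.

(** Products of noncommuting matrices are treated as atoms here: entry by
    entry, an identity that is linear in them is an identity of scalars. *)
Ltac mxlinear := apply/matrixP => ? ?; rewrite !mxlin; ring.
Ltac mxexpand := rewrite ?(mulrDl, mulrDr, mulrN, mulNr, mul1r, mulr1,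
                           scalerDr, scalerN, scalerA)
                   -?scalerAl -?scalerAr
                   ?(mul1r, mulr1, scalerDr, scalerN, scalerA).

(** * The relations between J, A and F *)

Section Sl2.
Variables (K : fieldType) (m : nat).
Variables (a N : K) (A J F E G H : 'M[K]_m.+1).
Hypothesis JA : J * A = A * J + A.
Hypothesis HJ : H = 2 *: J - (N + 1) *: 1.
Hypothesis AF : a *: (A * F) = a *: (F * A) + H.
Hypothesis EA : E = 1 + A.
Hypothesis GE : G * E = A.
Hypothesis EG : E * G = A.

Lemma J_mulE : J * E = E * J + A.
Proof. rewrite EA; mxexpand; rewrite JA; mxlinear. Qed.

Lemma H_mulE : H * E = E * H + 2 *: A.
Proof. rewrite HJ; mxexpand; rewrite J_mulE; mxlinear. Qed.

(** The case f(A) = (1 + A)^t of [J, f(A)] = A f'(A). *)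
Lemma conj_J t : E ^+ t * J = (J - t%:R *: G) * E ^+ t.
Proof.
elim: t => [|t IH]; first by rewrite !expr0 mul1r mulr1 scale0r subr0.
rewrite exprS -mulrA IH [RHS]mulrA mulrA; congr (_ * _).
mxexpand; rewrite J_mulE EG GE -natr1; mxlinear.
Qed.

Lemma E_mulF : a *: (E * F) = a *: (F * E) + H.
Proof. rewrite EA; mxexpand; rewrite AF; mxlinear. Qed.

(** The correction is quadratic in t because commuting with A twice brings F
    back to a multiple of A.  The extra factor E on the left clears one of the
    two inverses of E that the conjugate of F contains. *)
Lemma conj_F t : a *: (E ^+ t.+1 * F) =
  (a *: (E * F) + t%:R *: H - (t * t.+1)%:R *: G) * E ^+ t.
Proof.
elim: t => [|t IH].
  by rewrite expr1 expr0 mulr1 mul0n !scale0r subr0 addr0.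
rewrite exprS -mulrA scalerAr IH [in RHS]exprS [RHS]mulrA mulrA; congr (_ * _).
have EFE : a *: (E * F) * E = E * (a *: (E * F) - H).
  by rewrite {2}E_mulF addrK -scalerAl -scalerAr mulrA.
rewrite [RHS]mulrDl [in RHS]mulrDl EFE.
mxexpand; rewrite H_mulE GE EG !natrM -!natr1; mxlinear.
Qed.

(** The next two lemmas are the two halves of the Pearson equation.  Here T and
    T' stand for the diagonal matrices of the weights of parameters s and s + 1
    and Es for the transpose of E. *)

Section PearsonStep.
Variables (s t : nat) (T T' Es : 'M[K]_m.+1).
Hypothesis T'E : 2 *: T' = a *: ((s%:R *: 1 + J) * T).
Hypothesis TEs : (s%:R *: 1 + J) * T * Es = (s%:R *: 1 + J + F) * T.

Lemma pearson_next : 2 *: (E ^+ t.+1 * T' * Es ^+ t.+1) =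
  (a *: (E * (s%:R *: 1 + J + F)) + t%:R *: (H - a *: A) - (t * t.+1)%:R *: G)
   * (E ^+ t * T * Es ^+ t).
Proof.
have step X : 2 *: (E ^+ t.+1 * T' * X) =
    a *: (E ^+ t.+1 * ((s%:R *: 1 + J) * T) * X).
  by rewrite scalerAl scalerAr T'E -scalerAr -scalerAl.
rewrite step [Es ^+ _]exprS; set Q := s%:R *: 1 + J + F.
have -> : E ^+ t.+1 * ((s%:R *: 1 + J) * T) * (Es * Es ^+ t) =
   E ^+ t.+1 * Q * (T * Es ^+ t).
  by rewrite -mulrA [_ * T * _]mulrA TEs -!mulrA.
rewrite scalerAl -[E ^+ t * T * _]mulrA [RHS]mulrA; congr (_ * _).
have E1J : E ^+ t.+1 * J = (E * J - t%:R *: A) * E ^+ t.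
  by rewrite exprS -mulrA conj_J mulrA mulrBr -scalerAr EG.
rewrite /Q mulrDr mulrDr scalerDr conj_F E1J.
have -> : E ^+ t.+1 * (s%:R *: 1) = s%:R *: E * E ^+ t.
  by rewrite -scalerAr mulr1 -scalerAl exprS.
rewrite -mulrDl scalerAl -[LHS]mulrDl; congr (_ * _).
mxexpand; mxlinear.
Qed.

Lemma pearson_prev : 2 *: (E ^+ t * T' * Es ^+ t) =
  a *: ((s%:R *: 1 + J - t%:R *: G) * (E ^+ t * T * Es ^+ t)).
Proof.
rewrite scalerAl scalerAr T'E -scalerAr -scalerAl !mulrA; congr (_ *: (_ * _ * _)).
rewrite mulrDr mulrDl -scalerAr mulr1.
by rewrite conj_J !mulrDl -!scalerAl mul1r -addrA.
Qed.
End PearsonStep.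

(** L stands for exp(-aA) and Li for its inverse. *)

Variables (L Li : 'M[K]_m.+1) (S : 'M[K]_m.+1) (s : nat).
Hypothesis LLi : L * Li = 1.
Hypothesis LiL : Li * L = 1.
Hypothesis LA : L * A = A * L.
Hypothesis LJ : L * J = (J + a *: A) * L.
Hypothesis LF : L * F = (F - H - a *: A) * L.

Lemma Li_commA : Li * A = A * Li.
Proof.
by rewrite -[Li * A]mulr1 -LLi !mulrA -[Li * A * L]mulrA -LA mulrA LiL mul1r.
Qed.

Lemma conjLi X Y : L * X = Y * L -> X * Li = Li * Y.
Proof.
move=> h; rewrite -[X]mul1r -LiL -[Li * L * X]mulrA h mulrA -[LHS]mulrA LLi.
by rewrite mulr1.
Qed.

Lemma LiJ : Li * J = (J - a *: A) * Li.
Proof.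
have := conjLi LJ; mxexpand; rewrite Li_commA => ->; mxlinear.
Qed.

Lemma LiH : Li * H = (H - (2 * a) *: A) * Li.
Proof. rewrite HJ; mxexpand; rewrite LiJ; mxexpand; mxlinear. Qed.

Lemma LiF : Li * F = (F + H - a *: A) * Li.
Proof.
have := conjLi LF; mxexpand; rewrite LiH Li_commA => h; mxexpand; rewrite h.
mxexpand; mxlinear.
Qed.

Lemma LiE : Li * E = E * Li.
Proof. by rewrite EA mulrDl mulrDr mul1r mulr1 Li_commA. Qed.

Lemma LiG : E \is a GRing.unit -> Li * G = G * Li.
Proof.
move=> Eu; apply: (mulrI Eu); apply: (mulIr Eu).
by rewrite !mulrA EG -LiE -[Li * E * G]mulrA EG Li_commA.
Qed.

Hypothesis Eunit : E \is a GRing.unit.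
Variable r : K.
Hypothesis r_succ : r = s.+1%:R.
Hypothesis KS : ((N + r) *: 1 - J) * S = F.
Let alpha := H - a *: A - r *: G - s%:R *: 1 - J.
Let beta := a *: (E * (s%:R *: 1 + J + F)) + s%:R *: (H - a *: A) - (s * s.+1)%:R *: G.

(** alpha and beta are the coefficients of x and of 1 in the polynomial of the
    Pearson equation.  Both L^-1 = exp(aA) and E^(s+1) contribute to the
    derivative of f = exp(aA) (1+A)^(s+1), and J f = f J + A f'. *)
Lemma alpha_conj : alpha * (Li * E ^+ s.+1) = - (Li * E ^+ s.+1 * ((N + r) *: 1 - J)).
Proof.
have JLi : J * Li = Li * J + a *: (A * Li).
  rewrite LiJ; mxexpand; mxlinear.
have Jf : Li * E ^+ s.+1 * J = (J - a *: A - r *: G) * (Li * E ^+ s.+1).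
  rewrite -mulrA conj_J -r_succ mulrA [RHS]mulrA; congr (_ * _).
  mxexpand; rewrite LiJ LiG //; mxexpand; mxlinear.
rewrite mulrBr Jf /alpha HJ; mxexpand; rewrite r_succ -natr1; mxlinear.
Qed.

(** The shift from E^s to E^(s+1) between the two sides is the factor E that
    [conj_F] needs. *)
Lemma beta_conj : beta * (Li * E ^+ s) = a *: (Li * E ^+ s.+1 * (F + ((N + r) *: 1 - J))).
Proof.
have Jf : Li * E ^+ s.+1 * J = (J - a *: A - r *: G) * (Li * E ^+ s.+1).
  rewrite -mulrA conj_J -r_succ mulrA [RHS]mulrA; congr (_ * _).
  mxexpand; rewrite LiJ LiG //; mxexpand; mxlinear.
have Ff : a *: (Li * E ^+ s.+1 * F) =
   (a *: (E * (F + H - a *: A)) + s%:R *: (H - (2 * a) *: A)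
     - (s * s.+1)%:R *: G) * (Li * E ^+ s).
  rewrite -mulrA scalerAr conj_F mulrA [RHS]mulrA; congr (_ * _).
  have LiEF : Li * (E * F) = E * (F + H - a *: A) * Li.
    by rewrite mulrA LiE -!mulrA LiF.
  rewrite mulrBr mulrDr -!scalerAr LiEF LiH LiG //; mxexpand; mxlinear.
have fE : Li * E ^+ s.+1 = E * (Li * E ^+ s) by rewrite exprS !mulrA LiE.
have -> : a *: (Li * E ^+ s.+1 * (F + ((N + r) *: 1 - J))) =
   a *: (Li * E ^+ s.+1 * F)
   + a *: ((N + r) *: (Li * E ^+ s.+1) - Li * E ^+ s.+1 * J).
  mxexpand; mxlinear.
rewrite Ff Jf fE.
rewrite [X in _ + a *: X](_ : _ =
  ((N + r) *: E - (J - a *: A - r *: G) * E) * (Li * E ^+ s)); last first.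
  by move: (Li * _) => Z; mxexpand; rewrite !mulrA; mxlinear.
rewrite [a *: (_ * (Li * _))]scalerAl -[RHS]mulrDl; congr (_ * _).
have EH : E * H = 2 *: (E * J) - (N + 1) *: E by rewrite HJ; mxexpand.
have EAA : E * A = A * E by rewrite EA; mxexpand.
rewrite /beta; mxexpand; rewrite EH J_mulE GE EAA !natrM r_succ -natr1.
rewrite EA; mxexpand; mxlinear.
Qed.

(** With f = L^-1 E^(s+1) and D = N + r - J, the candidate for B_0 is
    a f (S + 1) (L^-1 E^s)^-1, while alpha f = - f D and D S = F. *)
Lemma alpha_B0 :
  alpha * (a *: (Li * E ^+ s * (E * S + E) * E^-1 ^+ s * L)) = - beta.
Proof.
have fS : Li * E ^+ s * (E * S + E) = Li * E ^+ s.+1 * (S + 1).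
  by rewrite exprSr [in RHS]mulrDr mulr1 mulrDr !mulrA.
have ZV : Li * E ^+ s * (E^-1 ^+ s * L) = 1.
  by rewrite exprVn mulrA mulrK ?LiL // unitrX.
have step f Z : alpha * f = - (f * ((N + r) *: 1 - J)) ->
    alpha * (a *: (f * (S + 1) * Z)) =
    - (a *: (f * (F + ((N + r) *: 1 - J))) * Z).
  move=> alf; rewrite -scalerAr !mulrA alf !mulNr scalerN -scalerAl.
  by rewrite -[f * _ * _]mulrA [_ * (S + 1)]mulrDr KS mulr1.
by rewrite fS -[_ * _ * L]mulrA step ?alpha_conj // -beta_conj -mulrA ZV mulr1.
Qed.

End Sl2.

(** * Matrices with entries given by functions on indices *)

Section Entries.
Variables (K : fieldType) (m : nat) (c : nat -> K).
Hypothesis cm : c m = 0.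

(** Entry functions take all natural numbers as arguments, so that shifting an
    index needs no proof that it stays in range; the hypothesis [c m = 0] makes
    the terms that leave the range vanish. *)
Definition mxof (f : nat -> nat -> K) : 'M[K]_m.+1 := \matrix_(i, j) f i j.
Definition lowmx := mxof (fun i j => if i == j.+1 then c j else 0).
Definition numj := mxof (fun i j => if i == j then i.+1%:R else 0).
Local Notation A := lowmx.
Local Notation J := numj.

Lemma eq_mxof f g : (forall i j, i <= m -> j <= m -> f i j = g i j)%N ->
  mxof f = mxof g.
Proof.
by move=> fg; apply/matrixP=> i j; rewrite !mxE fg // -ltnS.
Qed.

Lemma mxofD f g : mxof f + mxof g = mxof (fun i j => f i j + g i j).
Proof. by apply/matrixP=> i j; rewrite !mxE. Qed.
Lemma mxofN f : - mxof f = mxof (fun i j => - f i j).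
Proof. by apply/matrixP=> i j; rewrite !mxE. Qed.
Lemma mxofZ k f : k *: mxof f = mxof (fun i j => k * f i j).
Proof. by apply/matrixP=> i j; rewrite !mxE. Qed.
Lemma mxof1 k : k *: 1 = mxof (fun i j => if i == j then k else 0).
Proof.
by apply/matrixP=> i j; rewrite !mxE -val_eqE; case: eqP => _; rewrite ?mulr1 ?mulr0.
Qed.

Lemma lowmx_mul f :
  A * mxof f = mxof (fun i j => if i is k.+1 then c k * f k j else 0).
Proof.
apply/matrixP=> -[i ilt] j; rewrite -mulmxE !mxE /=.
case: i ilt => [|k] klt.
  by rewrite big1 // => k _; rewrite mxE mul0r.
rewrite (bigD1 (Ordinal (ltnW klt))) //= !mxE /= eqxx big1 ?addr0 // => i.
rewrite -val_eqE /= => ne; rewrite !mxE /= eqSS eq_sym (negbTE ne) mul0r //.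
Qed.

Lemma mul_lowmx f : mxof f * A = mxof (fun i j => f i j.+1 * c j).
Proof.
apply/matrixP=> i j; rewrite -mulmxE !mxE /=.
have [jm|jm] := eqVneq (j : nat) m.
  rewrite jm cm mulr0 big1 // => k _; rewrite !mxE /= jm.
  by rewrite ltn_eqF ?mulr0 // ltn_ord.
have j1 : (j.+1 < m.+1)%N by rewrite ltnS ltn_neqAle jm -ltnS /=.
rewrite (bigD1 (Ordinal j1)) //= !mxE /= eqxx big1 ?addr0 // => k.
by rewrite -val_eqE /= !mxE => /negbTE /= ->; rewrite mulr0.
Qed.

Lemma uppmx_mul f : A^T * mxof f = mxof (fun i j => c i * f i.+1 j).
Proof.
have -> : mxof f = (mxof (fun i j => f j i))^T by apply/matrixP=> i j; rewrite !mxE.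
rewrite -mulmxE -trmx_mul mulmxE mul_lowmx; apply/matrixP=> i j.
by rewrite !mxE mulrC.
Qed.

Lemma mul_uppmx f :
  mxof f * A^T = mxof (fun i j => if j is k.+1 then f i k * c k else 0).
Proof.
have -> : mxof f = (mxof (fun i j => f j i))^T by apply/matrixP=> i j; rewrite !mxE.
rewrite -mulmxE -trmx_mul mulmxE lowmx_mul; apply/matrixP=> i j; rewrite !mxE.
by case: (j : nat) => // k; rewrite mulrC.
Qed.

Lemma diagmx_mul (d : nat -> K) f : diag_mx (\row_i d i) * mxof f =
  mxof (fun i j => d i * f i j).
Proof. by apply/matrixP=> i j; rewrite -mulmxE mul_diag_mx !mxE. Qed.

Lemma mul_diagmx (d : nat -> K) f : mxof f * diag_mx (\row_i d i) =
  mxof (fun i j => f i j * d j).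
Proof. by apply/matrixP=> i j; rewrite -mulmxE mul_mx_diag !mxE. Qed.

Lemma numjE : J = diag_mx (\row_i (i.+1)%:R).
Proof.
by apply/matrixP=> i j; rewrite !mxE -val_eqE; case: eqP.
Qed.

Lemma numj_mul f : J * mxof f = mxof (fun i j => i.+1%:R * f i j).
Proof. by rewrite numjE (diagmx_mul (fun i => i.+1%:R)). Qed.

Lemma mul_numj f : mxof f * J = mxof (fun i j => f i j * j.+1%:R).
Proof. by rewrite numjE (mul_diagmx (fun i => i.+1%:R)). Qed.

Lemma uppmxE : A^T = mxof (fun i j => if j == i.+1 then c i else 0).
Proof. by apply/matrixP=> i j; rewrite !mxE. Qed.

Lemma numj_lowmx : J * A = A * J + A.
Proof.
rewrite numj_mul mul_numj mxofD; apply: eq_mxof => i j _ _.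
by case: eqP => [->|_]; [rewrite -[j.+2%:R]natr1; ring|rewrite mulr0 mul0r addr0].
Qed.

Variable a : K.
Hypothesis a0 : a != 0.
Hypothesis cE : forall k, c k ^+ 2 = (m - k)%:R / a.
Let N : K := m.+1%:R.
Let H := 2 *: J - (N + 1) *: 1.
Let F := J * A^T.

Lemma FE : F = mxof (fun i j => if j == i.+1 then i.+1%:R * c i else 0).
Proof.
rewrite /F uppmxE numj_mul; apply: eq_mxof => i j _ _.
by case: eqP => // _; rewrite mulr0.
Qed.

(** Without the factor J, the commutator of A and A^T would be a scalar except
    for one corner; weighting by J makes the diagonal of the commutator affine in the
    index: k (N-k) - (k-1) (N-k+1) = N + 1 - 2k. *)
Lemma lowmx_F : a *: (A * F) = a *: (F * A) + H.
Proof.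
rewrite FE /H mxof1 /numj lowmx_mul mul_lowmx !mxofZ mxofN !mxofD.
apply: eq_mxof => i j im jm; rewrite eqSS.
have aci k : a * c k ^+ 2 = (m - k)%:R by rewrite cE mulrCA mulfV ?mulr1.
case: i im => [|k] im; rewrite ?eqSS.
  case: (eqVneq 0%N j) => [<-|nj]; last by ring.
  transitivity (a * c 0 ^+ 2 + (2 - (N + 1))); last by ring.
  rewrite aci subn0 /N -natr1; ring.
case: (eqVneq j k.+1) => [->|nk]; last by ring.
  transitivity (k.+1%:R * (a * c k ^+ 2)); first by ring.
  transitivity (k.+2%:R * (a * c k.+1 ^+ 2) + (2 * k.+2%:R - (N + 1))); last by ring.
  by rewrite !aci (natrB _ im) (natrB _ (ltnW im)) /N -!natr1; ring.
Qed.

(** L is exp(-aA): conjugating by the diagonal matrix of the p i makes A the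
    unit shift, and [expcoef i j] is the coefficient (-a)^(i-j) / (i-j)!, zero
    for i < j.  Multiplied by [i.+1%:R - j%:R] its recurrence
    holds for all indices, those with a zero coefficient included. *)
Section L0.
Variables (L : 'M[K]_m.+1) (p : nat -> K) (expcoef : nat -> nat -> K).
Hypothesis LE : L = mxof (fun i j => p i / p j * expcoef i j).
Hypothesis p0 : forall i, (i <= m)%N -> p i != 0.
Hypothesis cp : forall k, (k < m)%N -> c k = p k.+1 / p k.
Hypothesis expcoefSS : forall i j, expcoef i.+1 j.+1 = expcoef i j.
Hypothesis expcoef_rec : forall i j, (i.+1%:R - j%:R) * expcoef i.+1 j = - a * expcoef i j.
Hypothesis expcoef_lt : forall i j, (i < j)%N -> expcoef i j = 0.

Lemma L_lowmx : L * A = A * L.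
Proof.
rewrite LE lowmx_mul mul_lowmx; apply: eq_mxof => i j im jm.
case: i im => [|i] im; first by rewrite expcoef_lt // mulr0 mul0r.
rewrite expcoefSS; have [jem|jnm] := eqVneq j m.
  by rewrite expcoef_lt ?jem // !mulr0 mul0r.
have jm' : (j < m)%N by rewrite ltn_neqAle jnm.
by rewrite !cp //; field; rewrite !p0 // (ltnW im).
Qed.

Lemma expcoef_prev i j :
  a * (if i is k.+1 then expcoef k j else 0) = (j%:R - i%:R) * expcoef i j.
Proof.
case: i => [|i]; last by rewrite -[RHS]opprK -mulNr opprB expcoef_rec; ring.
by case: j => [|j]; [ring|rewrite expcoef_lt // !mulr0].
Qed.

Lemma L_numj : L * J = (J + a *: A) * L.
Proof.
rewrite mulrDl -scalerAl LE lowmx_mul numj_mul mul_numj mxofZ mxofD.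
apply: eq_mxof => i j im jm.
have coef_prev : a * (if i is k.+1 then expcoef k j else 0) = (j%:R - i%:R) * expcoef i j.
  by rewrite expcoef_prev.
transitivity (i.+1%:R * (p i / p j * expcoef i j)
   + p i / p j * (a * (if i is k.+1 then expcoef k j else 0))); last first.
  congr (_ + _); case: i im {coef_prev} => [|k] im; first by rewrite !mulr0.
  by rewrite cp //; field; rewrite !p0 // (ltnW im).
rewrite coef_prev -!natr1; ring.
Qed.

(** After the scaling by p every term is a multiple of [expcoef i.+1 j], and
    what remains is a polynomial identity in the indices. *)
Lemma L_F : L * F = (F - H - a *: A) * L.
Proof.
rewrite mulrBl mulrBl /H mulrBl -!scalerAl mul1r {1 2}/F -[J * A^T * L]mulrA.
rewrite mulrA LE lowmx_mul uppmx_mul !numj_mul mul_numj mul_uppmx.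
rewrite !(mxofZ, mxofN, mxofD); apply: eq_mxof => i j im jm.
have aci k : c k ^+ 2 = (m - k)%:R / a by exact: cE.
have coef_prev : a * (if i is k.+1 then expcoef k j else 0) = (j%:R - i%:R) * expcoef i j.
  by rewrite expcoef_prev.
have coef_here : expcoef i j = - ((i.+1%:R - j%:R) * expcoef i.+1 j) / a.
  by rewrite expcoef_rec; field.
transitivity (p i / p j * (j%:R * (N - j%:R) / a * expcoef i.+1 j)).
  case: j jm {coef_prev coef_here} => [|k] km; first by ring.
  rewrite expcoefSS; transitivity (k.+1%:R * expcoef i k * p i * c k ^+ 2 / p k.+1).
    by rewrite cp //; field; rewrite !p0 // (ltnW km).
  rewrite aci natrB ?(ltnW km) // /N -!natr1; field; rewrite a0 p0 //.
have ci : c i * (p i.+1 / p j * expcoef i.+1 j) =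
   p i / p j * ((N - i.+1%:R) / a * expcoef i.+1 j).
  have [e|ne] := eqVneq i m.
    by rewrite e cm /N subrr !mul0r mulr0.
  have im' : (i < m)%N by rewrite ltn_neqAle ne.
  transitivity (c i ^+ 2 * p i / p j * expcoef i.+1 j).
    by rewrite cp //; field; rewrite !p0 // (ltnW im').
  by rewrite aci natrB // /N -!natr1; field; rewrite a0 p0.
have cl : a * (if i is k.+1 then c k * (p k / p j * expcoef k j) else 0) =
   p i / p j * (a * (if i is k.+1 then expcoef k j else 0)).
  case: i im {coef_prev coef_here ci} => [|k] im; first by rewrite !mulr0.
  by rewrite cp //; field; rewrite !p0 // (ltnW im).
rewrite cl coef_prev ci coef_here /N -!natr1; field; rewrite a0 p0 //.
Qed.

End L0.
End Entries.

(** * The real matrices behind the weight *)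

Section RealData.
Variables (R : realType) (m : nat) (a : R) (mu : nat -> R).
Hypothesis a_gt0 : 0 < a.
Hypothesis muP : mu_spec m a mu.

(** All matrices of the problem have real entries.  The suffix R marks their
    versions over R, where the algebra is carried out. *)
Definition subdiag k : R := Num.sqrt ((m - k)%:R / a).
Definition AR := lowmx m subdiag.
Definition JR : 'M[R]_m.+1 := numj R m.
Definition ER := 1 + AR.
Definition GR := AR * ER^-1.
Definition HR := 2 *: JR - (m.+1%:R + 1) *: 1.
Definition FR := JR * AR^T.
Definition expcoef i j : R := if (j <= i)%N then (- a) ^+ (i - j) / (i - j)`!%:R else 0.
Definition LR := mxof m (fun i j => mu i.+1 / mu j.+1 * expcoef i j).
Definition calAR s := mxof m (fun i j =>
  if j == i.+1 then i.+1%:R / (m.+1 + s - i.+1)%:R * subdiag i else 0).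
Definition TR l := diag_mx (\row_(i < m.+1) delta a l i.+1).
Definition weightR l x : 'M[R]_m.+1 :=
  (a ^+ x / x`!%:R) *: (ER ^+ (x + l) * TR l * ER^T ^+ (x + l)).

Lemma subdiag_last : subdiag m = 0.
Proof. by rewrite /subdiag subnn mul0r sqrtr0. Qed.

Lemma subdiag_sqr k : subdiag k ^+ 2 = (m - k)%:R / a.
Proof. by rewrite sqr_sqrtr // divr_ge0 // ltW. Qed.

Lemma ofR_inj : injective (@ofR R).
Proof. exact: (fmorph_inj (real_complex R)). Qed.

Lemma Amx_entry (i j : 'I_m.+1) :
  Amx m mu i j = ofR (if i == j.+1 :> nat then subdiag j else 0).
Proof. by rewrite (AmxE _ _ muP) subSS; case: eqP. Qed.

Lemma subdiag_mu k : (k < m)%N -> subdiag k = mu k.+2 / mu k.+1.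
Proof.
move=> km; have k1 : (k.+1 < m.+1)%N by [].
have := Amx_entry (Ordinal k1) (Ordinal (ltnW k1)).
by rewrite mxE /= eqxx => /ofR_inj.
Qed.

Lemma mu_neq0 k : (k <= m)%N -> mu k.+1 != 0.
Proof. by case: muP => h _ km; rewrite gt_eqF // h. Qed.

Lemma expcoefSS i j : expcoef i.+1 j.+1 = expcoef i j.
Proof. by rewrite /expcoef ltnS subSS. Qed.

Lemma expcoef_lt i j : (i < j)%N -> expcoef i j = 0.
Proof. by move=> ij; rewrite /expcoef leqNgt ij. Qed.

Lemma expcoef_rec i j : (i.+1%:R - j%:R) * expcoef i.+1 j = - a * expcoef i j.
Proof.
rewrite /expcoef; have [ji|] := leqP j i; last first.
  rewrite leq_eqVlt => /orP[/eqP <-|ij]; first by rewrite subrr mul0r mulr0.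
  by rewrite leqNgt ij !mulr0.
rewrite (leqW ji) subSn // exprS factS natrM -natrB ?(leqW ji) // subSn //.
by field; rewrite nat1r !pnatr_eq0 -lt0n fact_gt0.
Qed.

Lemma JR_AR : JR * AR = AR * JR + AR.
Proof. exact: numj_lowmx. Qed.

Lemma AR_FR : a *: (AR * FR) = a *: (FR * AR) + HR.
Proof. exact: (lowmx_F subdiag_last (lt0r_neq0 a_gt0) subdiag_sqr). Qed.

Lemma ER_unit : ER \is a GRing.unit.
Proof.
have trig : is_trig_mx ER.
  apply/is_trig_mxP => i j ij; rewrite !mxE -val_eqE /= ltn_eqF // ltn_eqF ?addr0 //.
  exact: ltnW.
rewrite -[_ \is a _]/(ER \in unitmx) unitmxE det_trig // big1 ?unitr1 // => i _.
by rewrite !mxE eqxx ltn_eqF // addr0.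
Qed.

Lemma GR_ER : GR * ER = AR.
Proof. by rewrite /GR mulrVK // ER_unit. Qed.

Lemma ER_GR : ER * GR = AR.
Proof.
rewrite /GR mulrA (_ : ER * AR = AR * ER) ?mulrK ?ER_unit //.
by rewrite /ER mulrDl mulrDr mul1r mulr1.
Qed.

Lemma LR_unit : LR \is a GRing.unit.
Proof.
have trig : is_trig_mx LR.
  by apply/is_trig_mxP => i j ij; rewrite !mxE expcoef_lt // mulr0.
rewrite -[_ \is a _]/(LR \in unitmx) unitmxE det_trig // big1 ?unitr1 // => i _.
by rewrite !mxE /expcoef leqnn subnn expr0 fact0 divr1 mulr1 divff // mu_neq0 // -ltnS.
Qed.

Lemma LR_AR : LR * AR = AR * LR.
Proof. apply: (L_lowmx subdiag_last (erefl LR) mu_neq0 subdiag_mu expcoefSS expcoef_lt). Qed.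

Lemma LR_JR : LR * JR = (JR + a *: AR) * LR.
Proof. exact: (L_numj (erefl LR) mu_neq0 subdiag_mu expcoef_rec expcoef_lt). Qed.

Lemma LR_FR : LR * FR = (FR - HR - a *: AR) * LR.
Proof.
exact: (L_F subdiag_last (lt0r_neq0 a_gt0) subdiag_sqr (erefl LR)
  mu_neq0 subdiag_mu expcoefSS expcoef_rec expcoef_lt).
Qed.

Lemma calAR_eq s : ((m.+1%:R + s.+1%:R) *: 1 - JR) * calAR s.+1 = FR.
Proof.
rewrite mulrBl -scalerAl mul1r numj_mul /FR FE mxofZ mxofN mxofD.
apply: eq_mxof => i j im jm; case: eqP => _; last by rewrite !mulr0 subrr.
have im' : (i.+1 <= m.+1 + s.+1)%N by rewrite (leq_trans (leq_ltn_trans im (ltnSn m))) ?leq_addr.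
rewrite -mulrBl -natrD -natrB // mulrA mulrCA mulfV ?mulr1 //.
by rewrite pnatr_eq0 -lt0n subn_gt0; lia.
Qed.

Lemma TR_mxof l : TR l = mxof m (fun i j => if i == j then delta a l i.+1 else 0).
Proof. by apply/matrixP=> i j; rewrite !mxE -val_eqE; case: eqP. Qed.

Lemma delta_rank l i : 2 * delta a l.+1 i.+1 = a * ((l%:R + i.+1%:R) * delta a l i.+1).
Proof.
rewrite /delta !subn1 !addnS /= addSn exprS factS natrM -addnS natrD.
by field; rewrite pnatr_eq0 -lt0n fact_gt0.
Qed.

Lemma delta_succ l i :
  i.+1%:R * delta a l i.+2 = (l%:R + i.+1%:R) * delta a l i.+1.
Proof.
rewrite /delta !subn1 !addnS /= !factS !natrM -addnS natrD.
by field; rewrite nat1r !pnatr_eq0 -lt0n fact_gt0.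
Qed.

Lemma TR_succ s : 2 *: TR s.+1 = a *: ((s%:R *: 1 + JR) * TR s).
Proof.
rewrite !TR_mxof mulrDl -scalerAl mul1r numj_mul !mxofZ mxofD mxofZ.
apply: eq_mxof => i j _ _.
by case: eqP => _; [rewrite delta_rank|]; ring.
Qed.

(** The ratio of consecutive entries of T turns (s + J) T A^T into F T, which
    is why F is the right partner of A. *)
Lemma TR_ER s : (s%:R *: 1 + JR) * TR s * ER^T = (s%:R *: 1 + JR + FR) * TR s.
Proof.
rewrite /ER linearD /= trmx1 mulrDr mulr1 [RHS]mulrDl; congr (_ + _).
rewrite [in LHS]TR_mxof mulrDl -scalerAl mul1r numj_mul mxofZ mxofD mul_uppmx.
rewrite /FR FE (mul_diagmx _ (fun i => delta a s i.+1)).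
apply: eq_mxof => i [|j] im jm /=; first by rewrite mul0r.
rewrite eqSS eq_sym; case: eqP => [->|_]; last by rewrite !mulr0 addr0 !mul0r.
transitivity (i.+1%:R * delta a s i.+2 * subdiag i); last by ring.
by rewrite delta_succ; ring.
Qed.

Lemma trmxX (M : 'M[R]_m.+1) k : (M ^+ k)^T = M^T ^+ k.
Proof.
elim: k => [|k IH]; first by rewrite !expr0 trmx1.
by rewrite exprS exprSr -!mulmxE trmx_mul IH.
Qed.

Lemma weightR_tr s x : (weightR s x)^T = weightR s x.
Proof.
rewrite /weightR linearZ /=; congr (_ *: _).
by rewrite -!mulmxE !trmx_mul !trmxX trmxK tr_diag_mx mulmxA.
Qed.

Definition pearson_up s (t : R) : 'M[R]_m.+1 :=
  a *: (ER * (s%:R *: 1 + JR + FR)) + t *: (HR - a *: AR) - (t * (t + 1)) *: GR.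

Lemma scaler_swap (V : lmodType R) (k l : R) (v : V) :
  k *: (l *: v) = l *: (k *: v).
Proof. by rewrite !scalerA mulrC. Qed.

Lemma weightR_succ s x : 2 *: weightR s.+1 x = pearson_up s (x + s)%:R * weightR s x.
Proof.
rewrite /weightR addnS scaler_swap.
rewrite (pearson_next JR_AR (erefl HR) AR_FR (erefl ER) GR_ER ER_GR (x + s) (TR_succ s) (TR_ER s)).
by rewrite -scalerAr /pearson_up natrM -natr1.
Qed.

(** The factor [x.+1%:R] comes from a a^x / x! = (x+1) a^(x+1) / (x+1)!. *)
Lemma weightR_prev s x : 2 *: weightR s.+1 x =
  (s%:R *: 1 + JR - (x.+1 + s)%:R *: GR) * (x.+1%:R *: weightR s x.+1).
Proof.
rewrite /weightR addnS scaler_swap.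
rewrite (pearson_prev JR_AR (erefl ER) GR_ER ER_GR (x + s).+1 _ (TR_succ s)).
rewrite -!scalerAr !scalerA addSn; congr (_ *: _).
by rewrite exprS factS natrM; field; rewrite nat1r !pnatr_eq0 -lt0n fact_gt0.
Qed.

(** Orthogonality is tested against falling factorials, because both ways of
    multiplying them by x in the Pearson equation are exact: x times the value
    at x is a combination of two of them, and x times the value at x - 1 is the
    next one. *)
Definition ffactR i x : R := (x ^_ i)%:R.

Lemma ffactR_succ i x : ffactR i.+1 x = (x%:R - i%:R) * ffactR i x.
Proof.
rewrite /ffactR ffactnSr natrM mulrC; have [ix|xi] := leqP i x; first by rewrite natrB.
by rewrite ffact_small // !mulr0.
Qed.

Lemma ffactR_shift i x : x.+1%:R * ffactR i x = ffactR i.+1 x.+1.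
Proof. by rewrite /ffactR ffactSS natrM. Qed.

(** The coefficients of the Pearson equation for the weight multiplied by the
    i-th falling factorial; i = 0 gives the alpha and beta above. *)
Definition pearson1 s i : 'M[R]_m.+1 :=
  HR - a *: AR - s.+1%:R *: GR - s%:R *: 1 - JR - i%:R *: GR.
Definition pearson0 s i : 'M[R]_m.+1 :=
  a *: (ER * (s%:R *: 1 + JR + FR)) + s%:R *: (HR - a *: AR) - (s * s.+1)%:R *: GR
  + i%:R *: (HR - a *: AR - (2 * s + 1 + i)%:R *: GR).

(** The factor 2 clears the denominator in the definition of T.  The terms of degree
    i + 2 cancel because the two halves of the Pearson equation have the same
    quadratic term - x^2 G. *)
Lemma pearson_nabla s i x :
  2 *: (ffactR i x *: weightR s.+1 x - (if x is y.+1 then ffactR i y *: weightR s.+1 y else 0)) =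
  (ffactR i.+1 x *: pearson1 s i + ffactR i x *: pearson0 s i) * weightR s x.
Proof.
have -> : 2 *: (ffactR i x *: weightR s.+1 x
      - (if x is y.+1 then ffactR i y *: weightR s.+1 y else 0)) =
  (ffactR i x *: pearson_up s (x + s)%:R
    - ffactR i.+1 x *: (s%:R *: 1 + JR - (x + s)%:R *: GR)) * weightR s x.
  rewrite scalerBr scaler_swap weightR_succ [RHS]mulrBl -!scalerAl; congr (_ - _).
  (* At x = 0 the missing term agrees with the factor x = 0 of the next falling
     factorial. *)
  case: x => [|y]; first by rewrite ffactR_succ /ffactR; case: i => [|i];
     rewrite ?subrr ?mul0r ?mulr0 ?scale0r ?scaler0.
  by rewrite scaler_swap weightR_prev -ffactR_shift -scalerAr scalerA mulrC.
congr (_ * _).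
rewrite ffactR_succ /pearson_up /pearson1 /pearson0 !natrD !natrM -natr1; mxlinear.
Qed.

End RealData.

(** * Convergence of series of complex matrices *)

Section Conv.
Local Open Scope classical_set_scope.
Variables (R : realType) (m : nat).
Local Notation C := (Cplx R).
Local Notation M := 'M[C]_m.+1.

Lemma cvg_ofR (u : nat -> R) (x : R) :
  u @ \oo --> x -> (fun n => ofR (u n)) @ \oo --> ofR x.
Proof.
move=> /cvgrPdist_lt ux; apply/cvgrPdist_lt => -[e i] /=; rewrite ltcE /= => /andP[/eqP-> e0].
have := ux _ e0; apply: filterS => n.
rewrite /ofR -(rmorphB (real_complex R)) /= normc_def /= expr0n addr0 sqrtr_sqr.
by rewrite ltcR.
Qed.

Lemma cvg_mxP (g : nat -> M) (S : M) :
  (g @ \oo --> S) <-> (forall i j, (fun n => g n i j) @ \oo --> S i j).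
Proof.
split=> [gS i j|gS].
  exact: (cvg_comp _ _ gS (@coord_continuous C _ _ i j S)).
apply/cvg_ballP => e e0.
have : \forall n \near \oo, forall ij : 'I_m.+1 * 'I_m.+1,
    ball (S ij.1 ij.2) e (g n ij.1 ij.2).
  by apply: filter_forall => -[i j] /=; have /cvg_ballP := gS i j; apply.
by apply: filterS => n gn; split => // i j; exact: (gn (i, j)).
Qed.

Lemma cvg_mx_lim (g : nat -> M) (S : M) : g @ \oo --> S -> limn g = S.
Proof. by move=> gS; apply/cvg_lim => //; exact: norm_hausdorff. Qed.

Lemma cvg_mulmxl (X : M) (g : nat -> M) S :
  g @ \oo --> S -> (fun n => X * g n) @ \oo --> X * S.
Proof.
move/cvg_mxP => gS; apply/cvg_mxP => i j; rewrite -mulmxE mxE.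
rewrite (_ : (fun n => _) = (fun n => \sum_k X i k * g n k j)); last first.
  by apply/funext => n; rewrite mxE.
apply: cvg_big => //; first exact: add_continuous.
by move=> k _; apply: cvgMl_tmp.
Qed.

Lemma cvg_mulmxr (X : M) (g : nat -> M) (S : M) :
  g @ \oo --> S -> (fun n => g n * X) @ \oo --> S * X.
Proof.
move/cvg_mxP => gS; apply/cvg_mxP => i j; rewrite -mulmxE mxE.
rewrite (_ : (fun n => _) = (fun n => \sum_k g n i k * X k j)); last first.
  by apply/funext => n; rewrite mxE.
apply: cvg_big => //; first exact: add_continuous.
by move=> k _; apply: cvgMr_tmp.
Qed.

Lemma cvg_mxD (g h : nat -> M) (S T : M) : g @ \oo --> S -> h @ \oo --> T ->
  (fun n => g n + h n) @ \oo --> S + T.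
Proof.
move=> /cvg_mxP gS /cvg_mxP hT; apply/cvg_mxP => i j; rewrite mxE.
rewrite (_ : (fun n => _) = fun n => g n i j + h n i j).
  exact: (cvgD (gS i j) (hT i j)).
by apply/funext => n; rewrite mxE.
Qed.

Lemma cvg_mxB0 (g h : nat -> M) : g @ \oo --> (0 : M) -> h @ \oo --> (0 : M) ->
  (fun n => g n - h n) @ \oo --> (0 : M).
Proof.
move=> /cvg_mxP gS /cvg_mxP hT; apply/cvg_mxP => i j.
rewrite (_ : (fun n => _) = fun n => g n i j - h n i j).
  have := cvgB (gS i j) (hT i j); rewrite !mxE subr0; exact.
by apply/funext => n; rewrite !mxE.
Qed.

Lemma normC_Re (z : C) B : `|z| <= ofR B -> `|complex.Re z| <= B.
Proof.
rewrite normc_def lecR; apply: le_trans.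
by rewrite -sqrtr_sqr ler_wsqrtr // lerDl sqr_ge0.
Qed.

Lemma normC_Im (z : C) B : `|z| <= ofR B -> `|complex.Im z| <= B.
Proof.
rewrite normc_def lecR; apply: le_trans.
by rewrite -sqrtr_sqr ler_wsqrtr // lerDr sqr_ge0.
Qed.

Lemma real_dominated_cvg (u : nat -> R) c K : 0 <= c -> 0 <= K ->
  (forall x, `|u x| <= c * (K ^+ x / x`!%:R)) -> cvgn (series u).
Proof.
move=> c0 K0 ub; apply: normed_cvg => /=.
apply: (@series_le_cvg _ _ (fun x => c * exp_coeff K x)) => //.
- by move=> x /=.
- by move=> x; rewrite mulr_ge0 // exp_coeff_ge0.
- exact: is_cvg_seriesZ (is_cvg_series_exp_coeff K).
Qed.

(** Domination gives convergence over the complete field R, hence the passage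
    through real and imaginary parts. *)
Lemma complex_dominated_cvg (z : nat -> C) c K : 0 <= c -> 0 <= K ->
  (forall x, `|z x| <= ofR (c * (K ^+ x / x`!%:R))) ->
  exists S : C, series z @ \oo --> S.
Proof.
move=> c0 K0 zb.
have cR : cvgn (series (fun x => complex.Re (z x))).
  by apply: (@real_dominated_cvg _ c K) => // x; exact: normC_Re.
have cI : cvgn (series (fun x => complex.Im (z x))).
  by apply: (@real_dominated_cvg _ c K) => // x; exact: normC_Im.
exists (ofR (limn (series (fun x => complex.Re (z x))))
      + ('i%C : C) * ofR (limn (series (fun x => complex.Im (z x))))).
have -> : series z = (fun n => ofR (series (fun x => complex.Re (z x)) n)
     + ('i%C : C) * ofR (series (fun x => complex.Im (z x)) n)).
  apply/funext => n; rewrite /series /= /ofR !(rmorph_sum (real_complex R)) mulr_sumr.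
  by rewrite -big_split /=; apply: eq_bigr => k _; rewrite -complexE.
apply: cvgD; first exact: cvg_ofR.
by apply: cvgMl_tmp; exact: cvg_ofR.
Qed.

(** Entries at most exponential, respectively at most exponential divided by a
    factorial: polynomials and powers are of the first kind, the weights of the second,
    and the product of the two kinds is of the second. *)
Definition growth (g : nat -> M) := exists c K : R, [/\ 0 <= c, 0 <= K &
  forall x i j, `|g x i j| <= ofR (c * K ^+ x)].
Definition fact_decay (g : nat -> M) := exists c K : R, [/\ 0 <= c, 0 <= K &
  forall x i j, `|g x i j| <= ofR (c * (K ^+ x / x`!%:R))].

Lemma series_entry (g : nat -> M) i j n :
  series g n i j = series (fun x => g x i j) n.
Proof. by rewrite /series /= summxE. Qed.

Lemma fact_decay_cvg g : fact_decay g -> exists S : M, series g @ \oo --> S.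
Proof.
move=> [c [K [c0 K0 gb]]].
have /choice[S SP] : forall ij : 'I_m.+1 * 'I_m.+1,
    exists S : C, series (fun x => g x ij.1 ij.2) @ \oo --> S.
  by move=> [i j]; exact: (complex_dominated_cvg c0 K0 (fun x => gb x i j)).
exists (\matrix_(i, j) S (i, j)); apply/cvg_mxP => i j; rewrite mxE.
rewrite (_ : (fun n => _) = series (fun x => g x i j)); first exact: (SP (i, j)).
by apply/funext => n; rewrite series_entry.
Qed.

Lemma fact_decay_cvg0 g : fact_decay g -> g @ \oo --> (0 : M).
Proof.
move=> /fact_decay_cvg [S gS]; apply: cvg_series_cvg_0.
by apply/cvg_ex; exists S.
Qed.

Lemma mx_bound_mul (g h : nat -> M) (b c : nat -> R) :
  (forall x i j, `|g x i j| <= ofR (b x)) ->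
  (forall x i j, `|h x i j| <= ofR (c x)) ->
  forall x i j, `|(g x * h x) i j| <= ofR (m.+1%:R * (b x * c x)).
Proof.
move=> gb hb x i j; rewrite -mulmxE mxE.
apply: le_trans (ler_norm_sum _ _ _) _.
rewrite mulr_natl /ofR (rmorphMn (real_complex R)) -[X in _ *+ X]card_ord -sumr_const.
apply: ler_sum => k _; rewrite normrM.
by rewrite (rmorphM (real_complex R)) ler_pM // ?gb ?hb.
Qed.

Lemma growth_fact_decay g h : growth h -> fact_decay g -> fact_decay (fun x => h x * g x).
Proof.
move=> [c' [K' [c0' K0' hb]]] [c [K [c0 K0 gb]]].
exists (m.+1%:R * (c' * c)), (K' * K); split; rewrite ?mulr_ge0 // => x i j.
rewrite (_ : _ * _ = m.+1%:R * ((c' * K' ^+ x) * (c * (K ^+ x / x`!%:R)))).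
  exact: (mx_bound_mul (b := fun x => _ * K' ^+ x) (c := fun x => c * (_ / _)) hb gb).
by rewrite exprMn; ring.
Qed.

Lemma fact_decay_growth g h : fact_decay g -> growth h -> fact_decay (fun x => g x * h x).
Proof.
move=> [c [K [c0 K0 gb]]] [c' [K' [c0' K0' hb]]].
exists (m.+1%:R * (c * c')), (K * K'); split; rewrite ?mulr_ge0 // => x i j.
rewrite (_ : _ * _ = m.+1%:R * ((c * (K ^+ x / x`!%:R)) * (c' * K' ^+ x))).
  exact: (mx_bound_mul (b := fun x => c * (_ / _)) (c := fun x => _ * K' ^+ x) gb hb).
by rewrite exprMn; ring.
Qed.

Lemma growthM g h : growth g -> growth h -> growth (fun x => g x * h x).
Proof.
move=> [c [K [c0 K0 gb]]] [c' [K' [c0' K0' hb]]].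
exists (m.+1%:R * (c * c')), (K * K'); split; rewrite ?mulr_ge0 // => x i j.
rewrite (_ : _ * _ = m.+1%:R * ((c * K ^+ x) * (c' * K' ^+ x))).
  exact: (mx_bound_mul (b := fun x => _ * K ^+ x) (c := fun x => _ * K' ^+ x) gb hb).
by rewrite exprMn; ring.
Qed.

Lemma growthD g h : growth g -> growth h -> growth (fun x => g x + h x).
Proof.
move=> [c [K [c0 K0 gb]]] [c' [K' [c0' K0' hb]]].
exists (c + c'), (K + K'); split; rewrite ?addr_ge0 // => x i j.
rewrite mxE; apply: le_trans (ler_normD _ _) _.
apply: le_trans (lerD (gb x i j) (hb x i j)) _.
rewrite /ofR -(rmorphD (real_complex R)) lecR mulrDl.
by rewrite lerD // ler_wpM2l // lerXn2r ?nnegrE ?addr_ge0 // ?lerDl ?lerDr.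
Qed.

Lemma mx_bound (X : M) : exists2 c : R, 0 <= c & forall i j, `|X i j| <= ofR c.
Proof.
pose n i j := complex.Re `|X i j|.
have n0 i j : 0 <= n i j by rewrite /n normc_def sqrtr_ge0.
exists (\sum_i \sum_j n i j) => [|i j].
  by apply: sumr_ge0 => i _; exact: sumr_ge0.
have -> : `|X i j| = ofR (n i j) by rewrite /n normc_def.
rewrite lecR (bigD1 i) //= (bigD1 j) //= -addrA lerDl addr_ge0 //.
  exact: sumr_ge0.
by apply: sumr_ge0 => k _; exact: sumr_ge0.
Qed.

Lemma growth_cst X : growth (fun=> X).
Proof.
have [c c0 Xc] := mx_bound X.
by exists c, 1; split => // x i j; rewrite expr1n mulr1.
Qed.

Lemma growth_expr X : growth (fun x => X ^+ x).
Proof.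
have [c c0 Xc] := mx_bound X.
exists 1, (m.+1%:R * c); split; rewrite ?mulr_ge0 // => x; rewrite mul1r.
elim: x => [|x IH] i j.
  by rewrite !expr0 mxE; case: eqP => _; rewrite ?normr1 ?normr0 // ?lecR /ofR ?ler0c.
rewrite exprSr exprSr mulrCA.
by have := @mx_bound_mul (fun=> X ^+ x) (fun=> X) (fun=> (m.+1%:R * c) ^+ x) (fun=> c)
   (fun=> IH) (fun=> Xc) 0%N i j.
Qed.

Lemma growth_shift g : growth g -> growth (fun x => g x.+1).
Proof.
move=> [c [K [c0 K0 gb]]]; exists (c * K), K; split; rewrite ?mulr_ge0 // => x i j.
by rewrite -mulrA -exprS.
Qed.

Lemma growth_nat : growth (fun x => x%:R).
Proof.
exists 1, 2; split => // x i j; rewrite mul1r.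
rewrite mulmxnE mxE; case: eqP => _; last first.
  by rewrite mul0rn normr0 /ofR ler0c exprn_ge0.
rewrite normr_nat (_ : x%:R = ofR x%:R); last first.
  by rewrite /ofR (rmorph_nat (real_complex R)).
by rewrite lecR -natrX ler_nat ltnW // ltn_expl.
Qed.

Lemma growth_evalN (P : {poly M}) : growth (evalN P).
Proof.
elim/poly_ind: P => [|P c IH].
  rewrite (_ : evalN 0 = fun=> 0); first exact: growth_cst.
  by apply/funext => x; rewrite /evalN horner0.
rewrite (_ : evalN _ = fun x => evalN P x * x%:R + c).
  by apply: growthD; [apply: growthM => //; exact: growth_nat|exact: growth_cst].
by apply/funext => x; rewrite /evalN hornerD hornerC hornerM_comm ?hornerX // /comm_poly hornerX.
Qed.

End Conv.

(** * The complex weight and its inner product *)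

Section Weight.
Local Open Scope classical_set_scope.
Variables (R : realType) (m : nat) (a : R) (mu : nat -> R).
Local Notation C := (Cplx R).
Local Notation M := 'M[C]_m.+1.
Hypothesis a_gt0 : 0 < a.
Hypothesis muP : mu_spec m a mu.

Definition toC : 'M[R]_m.+1 -> M := map_mx (real_complex R).

Lemma toCM X Y : toC (X * Y) = toC X * toC Y.
Proof. by rewrite -!mulmxE /toC map_mxM. Qed.
Lemma toCD X Y : toC (X + Y) = toC X + toC Y.
Proof. exact: map_mxD. Qed.
Lemma toCN X : toC (- X) = - toC X.
Proof. exact: map_mxN. Qed.
Lemma toC1 : toC 1 = 1.
Proof. exact: map_mx1. Qed.
Lemma toCX X n : toC (X ^+ n) = toC X ^+ n.
Proof. by elim: n => [|n IH]; rewrite ?expr0 ?toC1 // !exprS toCM IH. Qed.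
Lemma toCZ k X : toC (k *: X) = ofR k *: toC X.
Proof. exact: map_mxZ. Qed.
Lemma toC_unit X : X \is a GRing.unit -> toC X \is a GRing.unit.
Proof. by move=> Xu; rewrite -[_ \is a _]/(toC X \in unitmx) map_unitmx. Qed.
Lemma toCV X : X \is a GRing.unit -> toC X^-1 = (toC X)^-1.
Proof.
move=> Xu; apply: (mulrI (toC_unit Xu)).
by rewrite -toCM !mulrV ?toC1 // toC_unit.
Qed.

Lemma toC_trC X : (toC X) ^t* = toC X^T.
Proof.
by apply/matrixP=> i j; rewrite !mxE; apply: conj_Creal; rewrite complex_real.
Qed.

Lemma mulmx_trC p q r (X : 'M[C]_(p, q)) (Y : 'M[C]_(q, r)) :
  (X *m Y) ^t* = Y ^t* *m X ^t*.
Proof. by rewrite trmx_mul map_mxM. Qed.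

Lemma Amx_toC : Amx m mu = toC (AR m a).
Proof. by apply/matrixP => i j; rewrite (Amx_entry muP) !mxE. Qed.

Lemma IA_toC : 1 + Amx m mu = toC (ER m a).
Proof. by rewrite Amx_toC toCD toC1. Qed.

Lemma IAt_toC : 1 + (Amx m mu) ^t* = toC (ER m a)^T.
Proof. by rewrite Amx_toC toC_trC /ER linearD /= trmx1 toCD toC1. Qed.

Lemma Tmx_toC l : Tmx m a l = toC (TR m a l).
Proof.
apply/matrixP => i j; rewrite !mxE; by case: eqP => _; rewrite ?mulr1n ?mulr0n.
Qed.

Lemma L0mx_toC : L0mx m a mu = toC (LR m a mu).
Proof.
apply/matrixP => i j; rewrite !mxE /expcoef /ofR; case: ifP => // _.
by rewrite mulr0 (rmorph0 (real_complex R)).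
Qed.

Lemma calA_toC s : calA m a s = toC (calAR m a s).
Proof.
apply/matrixP => i j; by rewrite !mxE /subdiag subSS; case: ifP.
Qed.

Local Notation W := (weight m a mu).

Lemma weight_toC l x : W l x = toC (weightR m a l x).
Proof.
by rewrite /weight IA_toC IAt_toC Tmx_toC /weightR toCZ !toCM !toCX.
Qed.

Lemma growth_add_expr X l : growth (fun x => (X : M) ^+ (x + l)).
Proof.
rewrite (_ : (fun x => _) = fun x => X ^+ x * X ^+ l).
  by apply: growthM; [exact: growth_expr|exact: growth_cst].
by apply/funext => x; rewrite exprD.
Qed.

Lemma weight_fact_decay l : fact_decay (W l).
Proof.
have [c [K [c0 K0 gb]]] : growth (fun x => (1 + Amx m mu) ^+ (x + l) * Tmx m a l
    * (1 + (Amx m mu) ^t*) ^+ (x + l)).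
  apply: growthM; last exact: growth_add_expr.
  by apply: growthM; [exact: growth_add_expr|exact: growth_cst].
exists c, (a * K); split; rewrite ?mulr_ge0 // ?ltW // => x i j.
rewrite /weight mxE normrM.
have h0 : 0 <= a ^+ x / x`!%:R by rewrite divr_ge0 // exprn_ge0 // ltW.
have -> : `|ofR (a ^+ x / x`!%:R)| = ofR (a ^+ x / x`!%:R).
  by rewrite ger0_norm // /ofR ler0c.
apply: le_trans (ler_wpM2l _ (gb x i j)) _; first by rewrite /ofR ler0c.
rewrite /ofR -(rmorphM (real_complex R)) lecR exprMn.
by rewrite le_eqVlt; apply/orP; left; apply/eqP; ring.
Qed.

Lemma growth_trC (g : nat -> M) : growth g -> growth (fun x => (g x) ^t*).
Proof.
move=> [c [K [c0 K0 gb]]]; exists c, K; split => // x i j.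
by rewrite !mxE norm_conjC.
Qed.

Lemma inner_cvg l (P Q : {poly M}) :
  series (fun x => evalN P x * W l x * (evalN Q x) ^t*) @ \oo
    --> mx_inner (W l) P Q.
Proof.
have [S SP] : exists S : M,
   series (fun x => evalN P x * W l x * (evalN Q x) ^t*) @ \oo --> S.
  apply: fact_decay_cvg; apply: fact_decay_growth; last exact/growth_trC/growth_evalN.
  by apply: growth_fact_decay; [exact: growth_evalN|exact: weight_fact_decay].
by rewrite /mx_inner (cvg_mx_lim SP).
Qed.

Arguments inner_cvg l P Q : clear implicits.

Lemma inner_unique l (P Q : {poly M}) (S : M) :
  series (fun x => evalN P x * W l x * (evalN Q x) ^t*) @ \oo --> S ->
  mx_inner (W l) P Q = S.
Proof. exact: cvg_mx_lim. Qed.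

Lemma evalND (P Q : {poly M}) x : evalN (P + Q) x = evalN P x + evalN Q x.
Proof. exact: hornerD. Qed.
Lemma evalNC c (P : {poly M}) x : evalN (c%:P * P) x = c * evalN P x.
Proof. exact: hornerCM. Qed.
Lemma comm_polyN (P : {poly M}) x : comm_poly P x%:R.
Proof. by rewrite /comm_poly; apply/commr_sym/commr_nat. Qed.
Lemma evalNM (P Q : {poly M}) x : evalN (P * Q) x = evalN P x * evalN Q x.
Proof. by rewrite /evalN hornerM_comm //; exact: comm_polyN. Qed.
Lemma evalNX x : evalN ('X : {poly M}) x = x%:R.
Proof. exact: hornerX. Qed.

Lemma nat_trC x : (x%:R : M) ^t* = x%:R.
Proof.
by rewrite linearMn /= trmx1 raddfMn /= map_mx1.
Qed.

Lemma trCD (X Y : M) : (X + Y) ^t* = X ^t* + Y ^t*.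
Proof. by rewrite linearD /= map_mxD. Qed.

Lemma trCM (X Y : M) : (X * Y) ^t* = Y ^t* * X ^t*.
Proof. by rewrite -!mulmxE mulmx_trC. Qed.

Lemma eq_series_cvg (f g : nat -> M) (S : M) : f =1 g ->
  series f @ \oo --> S -> series g @ \oo --> S.
Proof. by move=> /funext->. Qed.

Lemma series_cvgD (f g : nat -> M) (S T : M) :
  series f @ \oo --> S -> series g @ \oo --> T ->
  series (fun x => f x + g x) @ \oo --> S + T.
Proof.
move=> fS gT; rewrite (_ : series _ = fun n => series f n + series g n); last first.
  by apply/funext => n; rewrite /series /= big_split.
exact: cvg_mxD fS gT.
Qed.

Lemma series_mull (X : M) f (S : M) : series f @ \oo --> S ->
  series (fun x => X * f x) @ \oo --> X * S.
Proof.
move=> fS; rewrite (_ : series _ = fun n => X * series f n); last first.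
  by apply/funext => n; rewrite /series /= mulr_sumr.
exact: cvg_mulmxl.
Qed.

Arguments series_mull X {f S} _.

Lemma series_mulr (X : M) f (S : M) : series f @ \oo --> S ->
  series (fun x => f x * X) @ \oo --> S * X.
Proof.
move=> fS; rewrite (_ : series _ = fun n => series f n * X); last first.
  by apply/funext => n; rewrite /series /= mulr_suml.
exact: cvg_mulmxr.
Qed.

Arguments series_mulr X {f S} _.

Lemma innerDl l (P P' Q : {poly M}) :
  mx_inner (W l) (P + P') Q = mx_inner (W l) P Q + mx_inner (W l) P' Q.
Proof.
have h := series_cvgD (inner_cvg l P Q) (inner_cvg l P' Q).
apply: inner_unique; apply: (eq_series_cvg _ h).
by move=> x; rewrite evalND !mulrDl.
Qed.

Lemma innerDr l (P Q Q' : {poly M}) :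
  mx_inner (W l) P (Q + Q') = mx_inner (W l) P Q + mx_inner (W l) P Q'.
Proof.
have h := series_cvgD (inner_cvg l P Q) (inner_cvg l P Q').
apply: inner_unique; apply: (eq_series_cvg _ h).
by move=> x; rewrite evalND trCD !mulrDr.
Qed.

Lemma innerCl l c (P Q : {poly M}) :
  mx_inner (W l) (c%:P * P) Q = c * mx_inner (W l) P Q.
Proof.
have h := series_mull c (inner_cvg l P Q).
apply: inner_unique; apply: (eq_series_cvg _ h).
by move=> x; rewrite evalNC !mulrA.
Qed.

Lemma innerCr l c (P Q : {poly M}) :
  mx_inner (W l) P (c%:P * Q) = mx_inner (W l) P Q * c ^t*.
Proof.
have h := series_mulr (c ^t*) (inner_cvg l P Q).
apply: inner_unique; apply: (eq_series_cvg _ h).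
by move=> x; rewrite evalNC trCM !mulrA.
Qed.

Lemma innerX l (P Q : {poly M}) :
  mx_inner (W l) ('X * P) Q = mx_inner (W l) P ('X * Q).
Proof.
apply: inner_unique; apply: (eq_series_cvg _ (inner_cvg l P ('X * Q))) => x.
rewrite !evalNM !evalNX trCM nat_trC -[RHS]mulrA -[RHS]mulrA.
by rewrite -(commr_nat (evalN P x * (W l x * (evalN Q x) ^t*))) !mulrA.
Qed.

End Weight.

(** * Orthogonality and differences *)

Lemma scaled_combination (K : fieldType) (B : algType K) (y w u v : B) (h p q : K) :
  p *: (y * w) * (h *: u) + q *: (y * w) * (h *: v) =
  y * (h *: (p *: (w * u) + q *: (w * v))).
Proof.
rewrite scalerDr mulrDr -!scalerAr -!scalerAl !mulrA !scalerA.
by rewrite ![h * _]mulrC.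
Qed.

Section Orth.
Local Open Scope classical_set_scope.
Variables (R : realType) (m : nat) (a : R) (mu : nat -> R).
Local Notation C := (Cplx R).
Local Notation M := 'M[C]_m.+1.
Hypothesis a_gt0 : 0 < a.
Hypothesis muP : mu_spec m a mu.
Local Notation W := (weight m a mu).

(** Orthogonality of f to all polynomials of degree less than k for W_s, tested
    on falling factorials. *)
Definition orth_upto s (f : nat -> M) k := forall i, (i < k)%N ->
  series (fun x => ofR (ffactR R i x) *: (f x * W s x)) @ \oo --> (0 : M).

Definition fdiff (f : nat -> M) x := f x.+1 - f x.

Lemma sum_by_parts (f V : nat -> M) n :
  \sum_(0 <= x < n) fdiff f x * V x =
  f n * (if n is k.+1 then V k else 0)
  - \sum_(0 <= x < n) f x * (V x - if x is k.+1 then V k else 0).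
Proof.
elim: n => [|n IH]; first by rewrite !big_nil mulr0 subr0.
by rewrite !big_nat_recr //= IH /fdiff mulrBl mulrBr; apply/matrixP => i j;
  rewrite !(mx_entryD, mx_entryN); ring.
Qed.

Lemma ofR_nat n : ofR n%:R = n%:R :> C.
Proof. exact: (rmorph_nat (real_complex R)). Qed.

Lemma mulmx_nat n (Y : M) : n%:R * Y = ofR n%:R *: Y.
Proof. by rewrite ofR_nat scaler_nat mulr_natl. Qed.

Lemma ffact_weight_decay i s : fact_decay (fun x => ofR (ffactR R i x) *: W s x).
Proof.
elim: i => [|i IH].
  rewrite (_ : (fun x => _) = W s); first exact: weight_fact_decay.
  by apply/funext => x; rewrite /ffactR ffactn0 /ofR (rmorph1 (real_complex R)) scale1r.
rewrite (_ : (fun x => _) = fun x => (x%:R + (- i%:R)) * (ofR (ffactR R i x) *: W s x)).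
  by apply: growth_fact_decay => //; apply: growthD; [exact: growth_nat|exact: growth_cst].
apply/funext => x; set Y := ofR (ffactR R i x) *: W s x.
rewrite mulrDl mulNr !mulmx_nat -scalerBl /Y [RHS]scalerA ffactR_succ.
by rewrite /ofR (rmorphM (real_complex R)) (rmorphB (real_complex R)).
Qed.

(** The weight is symmetric, so transposing the Pearson equation moves its
    coefficients to the right of the weight. *)
Lemma nabla_weightr s i x :
  2 *: (ofR (ffactR R i x) *: W s.+1 x
        - (if x is y.+1 then ofR (ffactR R i y) *: W s.+1 y else 0)) =
  ofR (ffactR R i.+1 x) *: (W s x * toC (pearson1 m a s i)^T)
  + ofR (ffactR R i x) *: (W s x * toC (pearson0 m a s i)^T).
Proof.
have Vt y : (ffactR R i y *: weightR m a s.+1 y)^T = ffactR R i y *: weightR m a s.+1 y.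
  by rewrite linearZ /= weightR_tr.
have tr : 2 *: (ffactR R i x *: weightR m a s.+1 x
      - (if x is y.+1 then ffactR R i y *: weightR m a s.+1 y else 0)) =
    ffactR R i.+1 x *: (weightR m a s x * (pearson1 m a s i)^T)
      + ffactR R i x *: (weightR m a s x * (pearson0 m a s i)^T).
  have -> : ffactR R i x *: weightR m a s.+1 x
      - (if x is y.+1 then ffactR R i y *: weightR m a s.+1 y else 0) =
      (ffactR R i x *: weightR m a s.+1 x
      - (if x is y.+1 then ffactR R i y *: weightR m a s.+1 y else 0))^T.
    by rewrite linearB /= Vt; case: x => [|y]; rewrite ?trmx0 ?Vt.
  rewrite -linearZ /= pearson_nabla // -mulmxE trmx_mul weightR_tr mulmxE linearD /=.
  by rewrite !linearZ /= mulrDr -!scalerAr.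
have prev : toC (if x is y.+1 then ffactR R i y *: weightR m a s.+1 y else 0) =
    if x is y.+1 then ofR (ffactR R i y) *: W s.+1 y else 0.
  by case: x {tr} => [|y]; [exact: map_mx0|rewrite toCZ -(weight_toC muP)].
have := congr1 (@toC R m) tr.
rewrite toCZ !toCD toCN !(toCZ (ffactR _ _ _)) !(toCM (weightR m a s x)) ofR_nat.
by rewrite -!(weight_toC muP) prev.
Qed.

(** Summation by parts moves the difference from f to the weight, and the
    Pearson equation turns the difference of the i-th test function times
    W_(s+1) into a combination of the test functions i and i + 1 times W_s.
    The boundary term f(n) W_(s+1)(n-1) tends to 0 by the factorial decay. *)
Lemma orth_upto_fdiff s f k : growth f -> orth_upto s f k.+1 -> orth_upto s.+1 (fdiff f) k.
Proof.
move=> gf fo i ik.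
pose V x := ofR (ffactR R i x) *: W s.+1 x.
have nb : series (fun x => f x * (V x - if x is k.+1 then V k else 0)) @ \oo --> (0 : M).
  have h1 := series_mulr (X := 2^-1 *: toC (pearson1 m a s i)^T) (fo i.+1 ik).
  have h0 := series_mulr (X := 2^-1 *: toC (pearson0 m a s i)^T) (fo i (leqW ik)).
  have := series_cvgD h1 h0; rewrite !mul0r addr0; apply: eq_series_cvg => x.
  have -> : V x - (if x is k.+1 then V k else 0) = 2^-1 *: (2 *:
      (V x - (if x is k.+1 then V k else 0))).
    move: (V x - _) => v; by rewrite scalerA mulVf ?scale1r // pnatr_eq0.
  rewrite nabla_weightr; move: (W s x) (f x) (toC _) (toC _) => w y u v.
  exact: scaled_combination.
have bd : (fun n => f n * (if n is k.+1 then V k else 0)) @ \oo --> (0 : M).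
  rewrite -cvg_shiftS /=.
  apply: fact_decay_cvg0; apply: growth_fact_decay; first exact: growth_shift.
  exact: ffact_weight_decay.
have := cvg_mxB0 bd nb.
rewrite (_ : (fun n => _ - _) = series (fun x => ofR (ffactR R i x) *:
    (fdiff f x * W s.+1 x))) //.
apply/funext => n; rewrite /series /= -sum_by_parts.
by apply: eq_bigr => x _; rewrite /V -scalerAr.
Qed.

End Orth.

(** * The first two moments *)

Section RealB.
Variables (R : realType) (m : nat) (a : R) (mu : nat -> R).
Hypothesis a_gt0 : 0 < a.
Hypothesis muP : mu_spec m a mu.
Local Notation E := (ER m a).
Local Notation L := (LR m a mu).

(** The matrix M_1 M_0^-1 for the weight of parameter s, that is, the
    coefficient B_0 of the recurrence for that weight. *)
Definition B0R s : 'M[R]_m.+1 :=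
  a *: (L^-1 * E ^+ s * (E * calAR m a s.+1 + E) * E^-1 ^+ s * L).

Lemma pearson1_0 s : pearson1 m a s 0 =
  HR R m - a *: AR m a - s.+1%:R *: GR m a - s%:R *: 1 - JR R m.
Proof. by rewrite /pearson1 scale0r subr0. Qed.

Lemma pearson1_B0R s : pearson1 m a s 0 * B0R s = - pearson0 m a s 0.
Proof.
have Lu := LR_unit muP.
rewrite pearson1_0 /pearson0 scale0r addr0.
exact: (alpha_B0 (@JR_AR _ _ _) (erefl _) (AR_FR _ a_gt0) (erefl _) (GR_ER _ _) (ER_GR _ _)
  (mulrV Lu) (mulVr Lu) (LR_AR muP) (LR_JR muP) (LR_FR a_gt0 muP) (ER_unit _ _) (erefl _)
  (calAR_eq m a_gt0 s)).
Qed.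

Lemma pearson1_unit s : pearson1 m a s 0 \is a GRing.unit.
Proof.
have Lu := LR_unit muP; have Eu := ER_unit m a.
set f := L^-1 * E ^+ s.+1.
have fu : f \is a GRing.unit by rewrite unitrMl ?unitrV // unitrX.
set K := (m.+1%:R + s.+1%:R) *: 1 - JR R m : 'M[R]_m.+1.
have Ku : K \is a GRing.unit.
  have -> : K = diag_mx (\row_i (m.+1%:R + s.+1%:R - i.+1%:R)).
    apply/matrixP => i j; rewrite !mxE -val_eqE; case: eqP => _ /=.
      by rewrite mulr1.
    by rewrite mulr0 subr0.
  rewrite -[_ \is a _]/(_ \in unitmx) unitmxE det_diag unitfE.
  apply/prodf_neq0 => i _; rewrite mxE subr_eq0 -natrD eqr_nat.
  by rewrite gtn_eqF // addnS ltnS (leq_trans (ltn_ord i)) // leq_addr.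
have h : pearson1 m a s 0 * f = - (f * K).
  rewrite pearson1_0.
  exact: (alpha_conj (@JR_AR _ _ _) (erefl _) (erefl _) (GR_ER _ _) (ER_GR _ _)
    (mulrV Lu) (mulVr Lu) (LR_AR muP) (LR_JR muP) (ER_unit _ _) (erefl _)).
by rewrite -(unitrMl _ fu) h unitrN unitrMl.
Qed.
End RealB.

Section FirstMoment.
Local Open Scope classical_set_scope.
Variables (R : realType) (m : nat) (a : R) (mu : nat -> R).
Local Notation C := (Cplx R).
Local Notation M := 'M[C]_m.+1.
Hypothesis a_gt0 : 0 < a.
Hypothesis muP : mu_spec m a mu.
Local Notation W := (weight m a mu).

Lemma nabla_weightl s x :
  2 *: (W s.+1 x - (if x is y.+1 then W s.+1 y else 0)) =
  toC (pearson1 m a s 0) * (ofR (ffactR R 1 x) *: W s x) + toC (pearson0 m a s 0) * W s x.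
Proof.
have transfer k (U V X P Q : 'M[R]_m.+1) : 2 *: (U - V) = (k *: P + Q) * X ->
    2 *: (toC U - toC V) = toC P * (ofR k *: toC X) + toC Q * toC X.
  move=> /(congr1 (@toC R m)); rewrite mulrDl -scalerAl scalerAr.
  by rewrite toCZ !toCD toCN ofR_nat !toCM toCZ.
have f0 y : ffactR R 0 y = 1 by rewrite /ffactR ffactn0.
have := pearson_nabla m a_gt0 s 0 x; rewrite f0 !scale1r => /transfer.
rewrite -!(weight_toC muP) => <-; congr (_ *: (_ - _)).
by case: x => [|y]; [rewrite /toC map_mx0|rewrite f0 scale1r (weight_toC muP)].
Qed.

(** The partial sums of the Pearson equation telescope to 2 W_(s+1)(n-1). *)
Lemma moment_relation s (M0 M1 : M) :
  series (W s) @ \oo --> M0 ->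
  series (fun x => ofR (ffactR R 1 x) *: W s x) @ \oo --> M1 ->
  toC (pearson1 m a s 0) * M1 + toC (pearson0 m a s 0) * M0 = 0.
Proof.
move=> h0 h1.
have := series_cvgD (series_mull (X := toC (pearson1 m a s 0)) h1)
                    (series_mull (X := toC (pearson0 m a s 0)) h0).
move/cvg_mx_lim => <-; apply: cvg_mx_lim.
have -> : series (fun x => toC (pearson1 m a s 0) * (ofR (ffactR R 1 x) *: W s x)
    + toC (pearson0 m a s 0) * W s x) =
    fun n => 2%:R * (if n is k.+1 then W s.+1 k else 0).
  apply/funext => n; rewrite /series /=.
  under eq_bigr do rewrite -nabla_weightl.
  rewrite -scaler_sumr mulmx_nat ofR_nat; congr (_ *: _).
  elim: n => [|n IH]; first by rewrite big_nil.
  by rewrite big_nat_recr //= IH addrC subrK.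
rewrite -cvg_shiftS /=; apply: fact_decay_cvg0; apply: growth_fact_decay.
  exact: growth_cst.
exact: weight_fact_decay.
Qed.

Lemma Tmx_pos s (v : 'rV[C]_m.+1) : v != 0 -> 0 < (v *m Tmx m a s *m v ^t*) 0 0.
Proof.
move=> v0.
have d0 k : 0 < delta a s k.+1.
  by rewrite /delta mulr_gt0 ?exprn_gt0 ?divr_gt0 // ltr0n fact_gt0.
have [k vk] : exists k, v 0 k != 0.
  apply/existsP; rewrite -negb_forall; apply: contra v0 => /forallP v0.
  by apply/eqP/rowP => k; rewrite mxE; apply/eqP.
rewrite mxE (bigD1 k) //=.
have term i : (v *m Tmx m a s) 0 i * (v ^t*) i 0 = ofR (delta a s i.+1) * `|v 0 i| ^+ 2.
  by rewrite mul_mx_diag !mxE normCK mulrCA mulrA.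
rewrite term ltr_pwDl //.
  by rewrite mulr_gt0 ?exprn_gt0 ?normr_gt0 // /ofR ltcR.
by apply: sumr_ge0 => i _; rewrite term mulr_ge0 ?exprn_ge0 // /ofR ler0c ltW.
Qed.

Lemma weight_pos s x (u : 'rV[C]_m.+1) : u != 0 -> 0 < (u *m W s x *m u ^t*) 0 0.
Proof.
move=> u0; rewrite /weight (IA_toC muP) (IAt_toC muP).
set X := toC (ER m a) ^+ (x + s).
have XE : X = toC (ER m a ^+ (x + s)) by rewrite toCX.
have Xt : toC (ER m a)^T ^+ (x + s) = X ^t* by rewrite XE toC_trC trmxX toCX.
have Xu : X \in unitmx by rewrite -[_ \in _]/(X \is a GRing.unit) XE toC_unit // unitrX ?ER_unit.
rewrite Xt -scalemxAr -scalemxAl mxE mulr_gt0 //.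
  by rewrite /ofR ltcR divr_gt0 ?exprn_gt0 // ltr0n fact_gt0.
rewrite -!mulmxE !mulmxA -[_ *m X ^t* *m _]mulmxA -mulmx_trC.
apply: Tmx_pos.
by apply: contra u0 => /eqP uX; rewrite -(mulmxK Xu u) uX mul0mx.
Qed.

(** If u M_0 = 0, then the positive numbers obtained by pairing u W_s(x) with u
    sum to 0, although their partial sums stay above the first of them. *)
Lemma moment0_unit s (M0 : M) : series (W s) @ \oo --> M0 -> M0 \is a GRing.unit.
Proof.
move=> h; rewrite -[_ \is a _]/(M0 \in unitmx) unitmxE unitfE.
apply/negP => /det0P[u u0 uM].
have pos x := weight_pos s x u0.
pose q x : C := (u *m W s x *m u ^t*) 0 0.
have q0 : series q @ \oo --> (0 : C).
  have -> : (0 : C) = \sum_j (\sum_k u 0 k * M0 k j) * (u ^t*) j 0.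
    have : (u *m M0 *m u ^t*) 0 0 = 0 by rewrite uM mul0mx mxE.
    by rewrite mxE; under eq_bigr do rewrite mxE.
  have -> : series q = fun n => \sum_j (\sum_k u 0 k * series (W s) n k j) * (u ^t*) j 0.
    apply/funext => n; rewrite /series /=.
    transitivity ((u *m (\sum_(0 <= k < n) W s k) *m u ^t*) 0 0).
      by rewrite mulmx_sumr mulmx_suml summxE.
    by rewrite mxE; apply: eq_bigr => j _; rewrite mxE.
  apply: cvg_big; first exact: add_continuous.
  move=> j _; apply: cvgMr_tmp; apply: cvg_big; first exact: add_continuous.
  by move=> k _; apply: cvgMl_tmp; move/cvg_mxP : h; apply.
move/cvgrPdist_lt/(_ _ (pos 0%N)) : q0 => [n _ /(_ n.+1 (leqnSn n))] /=.
rewrite sub0r normrN ger0_norm; last by apply: sumr_ge0 => k _; exact: ltW (pos _).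
move=> qn; have {qn} : series q n.+1 < q 0%N by exact: qn.
rewrite /series /= big_nat_recl // => qn.
have : q 0%N + \sum_(0 <= k < n) q k.+1 < q 0%N + 0 by rewrite [X in _ < X]addr0.
rewrite ltrD2l => neg.
have : 0 <= \sum_(0 <= k < n) q k.+1 by apply: sumr_ge0 => k _; exact: ltW (pos _).
by move/le_lt_trans/(_ neg); rewrite ltxx.
Qed.

Local Notation B s := (toC (B0R m a mu s)).

(** Both p_1 M_1 + p_0 M_0 = 0 and M_1 = B_0 M_0 hold, and M_0 cancels. *)
Lemma orth_upto_linear s (p : {poly M}) : (size p <= 2)%N ->
  orth_upto a mu s (evalN p) 1 -> p`_0 = - (p`_1 * B s).
Proof.
move=> p2 po.
have [M0 h0] := fact_decay_cvg (weight_fact_decay m mu a_gt0 s).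
have [M1 h1] := fact_decay_cvg (ffact_weight_decay m mu a_gt0 1 s).
have ev x : evalN p x = p`_1 * x%:R + p`_0.
  rewrite /evalN (horner_coef_wide _ p2) 2!big_ord_recl big_ord0 /=.
  by rewrite expr0 mulr1 addr0 expr1 addrC.
have z : p`_1 * M1 + p`_0 * M0 = 0.
  have := series_cvgD (series_mull (X := p`_1) h1) (series_mull (X := p`_0) h0).
  move/cvg_mx_lim => <-; rewrite -[RHS](cvg_mx_lim (po 0%N (ltnSn 0))).
  congr (limn (series _)); apply/funext => x; rewrite ev mulrDl scalerDr.
  rewrite /ffactR ffactn0 ffactn1 !ofR_nat; move: (W s x) => w.
  by rewrite !scale1r -mulrA mulr_natl scaler_nat.
have M0u := moment0_unit h0.
have alu : toC (pearson1 m a s 0) \is a GRing.unit by rewrite toC_unit // (pearson1_unit muP).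
have alB : toC (pearson1 m a s 0) * B s = - toC (pearson0 m a s 0).
  by rewrite -toCM (pearson1_B0R a_gt0 muP) toCN.
have M1E : M1 = B s * M0.
  apply: (mulrI alu); rewrite mulrA alB mulNr; apply/eqP.
  by rewrite -addr_eq0 (moment_relation h0 h1).
apply/eqP; rewrite -addr_eq0; apply/eqP; apply: (mulIr M0u).
by rewrite mul0r mulrDl -[_ * _ * M0]mulrA -M1E addrC.
Qed.

End FirstMoment.

(** * Subleading coefficients *)

Section Pdiff.
Variable (A : nzRingType).
Implicit Types p : {poly A}.

(** The forward difference of p, by Taylor expansion with step 1; n + 2 bounds
    the number of coefficients of p. *)
Definition pdiff n p := \sum_(i < n.+1) p^`N(i.+1).

Lemma pdiffE n p (x : nat) : (size p <= n.+2)%N ->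
  (pdiff n p).[x%:R] = p.[x.+1%:R] - p.[x%:R].
Proof.
move=> pn; rewrite -natr1 (nderiv_taylor_wide (commr1 _) pn).
rewrite big_ord_recl /= nderivn0 expr0 mulr1 addrC addKr.
by rewrite /pdiff horner_sum; apply: eq_bigr => i _; rewrite expr1n mulr1.
Qed.

Lemma coef_pdiff n p j : (pdiff n p)`_j =
  \sum_(i < n.+1) p`_(i.+1 + j) *+ 'C(i.+1 + j, i.+1).
Proof.
by rewrite /pdiff coef_sum; apply: eq_bigr => i _; rewrite coef_nderivn.
Qed.

Lemma size_pdiff n p : (size p <= n.+2)%N -> (size (pdiff n p) <= n.+1)%N.
Proof.
move=> pn; apply/leq_sizeP => j nj; rewrite coef_pdiff big1 // => i _.
by rewrite nth_default ?mul0rn // (leq_trans pn) // addSn ltnS (leq_trans nj) // leq_addl.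
Qed.

Lemma coef_pdiff_lead n p : (size p <= n.+2)%N ->
  (pdiff n p)`_n = p`_n.+1 *+ n.+1.
Proof.
move=> pn; rewrite coef_pdiff big_ord_recl big1 ?addr0 /= => [|i _].
  by rewrite add1n bin1.
by rewrite nth_default ?mul0rn // (leq_trans pn) //= /bump /= !addSn !ltnS leq_addl.
Qed.

Lemma coef_pdiff_sub n p : (size p <= n.+3)%N ->
  (pdiff n.+1 p)`_n = p`_n.+1 *+ n.+1 + p`_n.+2 *+ 'C(n.+2, 2).
Proof.
move=> pn; rewrite coef_pdiff 2!big_ord_recl big1 ?addr0 /= => [|i _].
  by rewrite add1n bin1 /bump /= add2n.
by rewrite nth_default ?mul0rn // (leq_trans pn) //= /bump /= !addSn !ltnS leq_addl.
Qed.

End Pdiff.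

(** The induction step of [subleading], as an identity of coefficients: u and v
    are the subleading and leading coefficients of the polynomial. *)
Lemma subleading_step (K : numFieldType) m n (b u v : 'M[K]_m.+1) :
  u *+ n.+1 + v *+ 'C(n.+2, 2) =
    - (v *+ n.+2 * (n.+1%:R *: b + 'C(n.+1, 2)%:R *: 1)) ->
  u = - (v * (n.+2%:R *: b + 'C(n.+2, 2)%:R *: 1)).
Proof.
have n1 : n.+1%:R != 0 :> K by rewrite pnatr_eq0.
have bin k : 'C(k.+1, 2)%:R = (k%:R + 1) * k%:R / 2 :> K.
  apply: (@mulIf _ 2); first by rewrite pnatr_eq0.
  rewrite divfK ?pnatr_eq0 // -natrM mulnC -mul_bin_diag bin1 natrM.
  by rewrite -natr1.
rewrite mulrnAl !mulrDr -!scalerAr mulr1 => h.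
apply/matrixP => i j; move/matrixP/(_ i j): h.
rewrite !(mulmxnE, mxlin) -[_ *+ n.+1]mulr_natl -[_ *+ 'C(_, _)]mulr_natl.
rewrite -[_ *+ n.+2]mulr_natl !bin -[n.+2%:R]natr1 -[n.+1%:R]natr1.
rewrite -[n.+1%:R]natr1 in n1 *.
move: ((v * b) i j) (u i j) (v i j) (n%:R) n1 => w y z x x1 h.
apply: (mulfI x1); apply: (@addIr _ ((x + 1 + 1) * (x + 1) / 2 * z)).
by rewrite [LHS]h; field.
Qed.

Section SubLead.
Local Open Scope classical_set_scope.
Variables (R : realType) (m : nat) (a : R) (mu : nat -> R).
Local Notation C := (Cplx R).
Local Notation M := 'M[C]_m.+1.
Hypothesis a_gt0 : 0 < a.
Hypothesis muP : mu_spec m a mu.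
Local Notation B s := (toC (B0R m a mu s)).

(** Each difference lowers the degree and raises the parameter of the weight by
    one, down to a polynomial of degree one orthogonal to the constants. *)
Lemma subleading n s (p : {poly M}) : (size p <= n.+2)%N ->
  orth_upto a mu s (evalN p) n.+1 ->
  p`_n = - (p`_n.+1 * (n.+1%:R *: B (s + n) + 'C(n.+1, 2)%:R *: 1)).
Proof.
elim: n s p => [|n IH] s p pn po.
  rewrite addn0 scale1r bin_small // scale0r addr0.
  exact: (orth_upto_linear a_gt0 muP).
have dE : evalN (pdiff n.+1 p) =1 fdiff (evalN p).
  by move=> x; rewrite /evalN pdiffE.
have dpo : orth_upto a mu s.+1 (evalN (pdiff n.+1 p)) n.+1.
  rewrite (_ : evalN _ = fdiff (evalN p)); last exact/funext.
  by apply: (orth_upto_fdiff a_gt0 muP) => //; exact: growth_evalN.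
have := IH _ _ (size_pdiff pn) dpo.
rewrite (coef_pdiff_lead pn) (coef_pdiff_sub pn) addSnnS.
exact: subleading_step.
Qed.

End SubLead.

(** * The closed form of B_n *)

Section BAlg.
Variables (K : fieldType) (B : unitAlgType K) (a : K) (E Li L : B) (S : nat -> B).
Hypothesis Eu : E \is a GRing.unit.
Hypothesis LiL : Li * L = 1.
Hypothesis a0 : a != 0.

(** The shape of B_0(s), for an arbitrary family S in the place of calA. *)
Definition B0form s := a *: (Li * E ^+ s * (E * S s.+1 + E) * E^-1 ^+ s * L).

(** Conjugating by one more power of E exchanges the factors E S and S E, so
    that B_0(l+n-1) and B_0(l+n) can be written with the same outer factors. *)
Lemma B0form_conj k : B0form k =
  a *: (Li * E ^+ k.+1 * (S k.+1 * E + E) * (E^-1 ^+ k.+1 * L)).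
Proof.
rewrite /B0form; congr (_ *: _).
have -> : E * S k.+1 + E = E * (S k.+1 * E + E) * E^-1.
  by rewrite mulrDr mulrDl !mulrA !mulrK.
by rewrite [E ^+ k.+1]exprSr [E^-1 ^+ k.+1]exprS !mulrA.
Qed.

(** The outer factors contribute a, so the summand n becomes n / a inside them. *)
Lemma B0form_combine s n :
  n.+1%:R *: B0form (s + n) - (if n is k.+1 then n%:R *: B0form (s + k) else 0)
    + n%:R *: 1 =
  a *: (Li * E ^+ (n + s) * (n.+1%:R * E * S (n + s).+1 - n%:R * S (n + s) * E
     + E + (n%:R / a) *: 1) * (E^-1 ^+ (n + s) * L)).
Proof.
pose w Y := a *: (Li * E ^+ (n + s) * Y * (E^-1 ^+ (n + s) * L)).
have wZ c Y : c *: w Y = w (c *: Y).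
  by rewrite /w scalerA mulrC -scalerA -scalerAr -scalerAl.
have wD Y Z : w Y + w Z = w (Y + Z).
  by rewrite /w -scalerDr -mulrDl -mulrDr.
have wN Y : - w Y = w (- Y) by rewrite /w mulrN mulNr scalerN.
have w1 : 1 = w (a^-1 *: 1).
  rewrite /w -scalerAr mulr1 -scalerAl scalerA mulfV // scale1r exprVn mulrA.
  by rewrite mulrK ?LiL // unitrX.
have prev : (if n is k.+1 then n%:R *: B0form (s + k) else 0) =
    n%:R *: w (S (n + s) * E + E).
  rewrite /w; case: n {w wZ wD wN w1} => [|k]; first by rewrite scale0r.
  by rewrite B0form_conj (addnC s) -addSn.
have cur : B0form (s + n) = w (E * S (n + s).+1 + E).
  by rewrite /B0form /w (addnC s) !mulrA.
rewrite prev cur [X in _ + n%:R *: X]w1 !wZ wN !wD -/(w _); congr (w _).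
have natl c (Y : B) : c%:R * Y = c%:R *: Y by rewrite mulr_natl scaler_nat.
rewrite -!mulrA !natl scalerA; congr (_ + _).
rewrite !scalerDr opprD addrACA; congr (_ + _).
by rewrite -scalerBl -natr1 addrC addKr scale1r.
Qed.

End BAlg.

(** * The three term recurrence *)

Section MonicLead.
Variable B : nzRingType.
Implicit Types p q : {poly B}.

Lemma monic_lead_coef k p : p \is monic -> size p = k.+1 -> p`_k = 1.
Proof. by move=> /monicP; rewrite lead_coefE => + sp; rewrite sp. Qed.

Lemma size_sub_lead k p q : p \is monic -> size p = k.+1 -> (size q <= k.+1)%N ->
  (size (q - (q`_k)%:P * p)%R <= k)%N.
Proof.
move=> pm sp sq; apply/leq_sizeP => j; rewrite leq_eqVlt => /orP[/eqP <-|kj].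
  by rewrite coefB coefCM (monic_lead_coef pm sp) mulr1 subrr.
rewrite coefB coefCM [p`_j]nth_default ?sp // mulr0 subr0.
by rewrite nth_default // (leq_trans sq).
Qed.
End MonicLead.

Lemma scalar_mul_natB (K : comNzRingType) (B : lalgType K) (c : K) x i :
  (c *: 1) * (x%:R - i%:R) = ((x%:R - i%:R) * c) *: (1 : B).
Proof.
by rewrite -scalerAl mul1r mulrC -scalerA scalerBl !scaler_nat.
Qed.

Section OrthPoly.
Local Open Scope classical_set_scope.
Variables (R : realType) (m : nat) (a : R) (mu : nat -> R) (l : nat).
Local Notation C := (Cplx R).
Local Notation M := 'M[C]_m.+1.
Variable P : nat -> {poly M}.
Hypothesis a_gt0 : 0 < a.
Hypothesis muP : mu_spec m a mu.
Local Notation W := (weight m a mu l).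
Local Notation "<| p , q |>" := (mx_inner W p q).
Hypothesis Po : monic_orthogonal W P.
Local Notation H n := (<|P n, P n|>).
Hypothesis Hu : forall n, H n \is a GRing.unit.

Let Pm n : P n \is monic. Proof. by case: Po => /(_ n)[]. Qed.
Let Ps n : size (P n) = n.+1. Proof. by case: Po => /(_ n)[]. Qed.
Let Port n k : n != k -> <|P n, P k|> = 0. Proof. by case: Po => _; apply. Qed.

Let split k (q : {poly M}) : q = (q`_k)%:P * P k + (q - (q`_k)%:P * P k).
Proof. by rewrite addrC subrK. Qed.

Let inner0l (q : {poly M}) : <|0, q|> = 0.
Proof. by have := innerCl mu a_gt0 l 0 0 q; rewrite mulr0 mul0r. Qed.
Let inner0r (q : {poly M}) : <|q, 0|> = 0.
Proof. by have := innerCr mu a_gt0 l 0 q 0; rewrite mulr0 trmx0 map_mx0 mulr0. Qed.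

(** As the P k are monic, a polynomial of low degree is a combination of the
    P k with coefficients on the left. *)
Lemma inner_lowr n k (q : {poly M}) : (size q <= k)%N -> (k <= n)%N -> <|P n, q|> = 0.
Proof.
elim: k q => [|k IH] q; first by rewrite leqn0 size_poly_eq0 => /eqP-> _; exact: inner0r.
move=> sq kn; rewrite (split k q) innerDr // innerCr // Port ?gtn_eqF // mul0r add0r.
by rewrite IH ?(ltnW kn) // size_sub_lead.
Qed.

Lemma inner_lowl n k (q : {poly M}) : (size q <= k)%N -> (k <= n)%N -> <|q, P n|> = 0.
Proof.
elim: k q => [|k IH] q; first by rewrite leqn0 size_poly_eq0 => /eqP-> _; exact: inner0l.
move=> sq kn; rewrite (split k q) innerDl // innerCl // Port ?ltn_eqF // mulr0 add0r.
by rewrite IH ?(ltnW kn) // size_sub_lead.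
Qed.

Lemma inner_eq0 n (q : {poly M}) : (size q <= n)%N ->
  (forall k, (k < n)%N -> <|q, P k|> = 0) -> q = 0.
Proof.
elim: n q => [|n IH] q; first by rewrite leqn0 size_poly_eq0 => /eqP.
move=> sq qo; apply: IH => [|k kn]; last by rewrite qo // ltnW.
have ss := size_sub_lead (Pm n) (Ps n) sq.
have := qo n (ltnSn n); rewrite {1}(split n q) innerDl // innerCl //.
rewrite (inner_lowl ss) // addr0 => h.
have q0 : q`_n = 0 by apply: (mulIr (Hu n)); rewrite mul0r.
by rewrite q0 mul0r subr0 in ss.
Qed.

(** X P_n is P_(n+1) up to lower degree, and X can be moved across the inner
    product. *)
Lemma inner_XP n : <|'X * P n.+1, P n|> = H n.+1.
Proof.
rewrite (innerX mu a_gt0).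
have sX : (size ('X * P n)%R <= n.+2)%N.
  by rewrite -commr_polyX size_mulX ?Ps // monic_neq0.
have XPn : ('X * P n)`_n.+1 = 1.
  by rewrite coefXM /= (monic_lead_coef (Pm n)).
have low := size_sub_lead (Pm n.+1) (Ps n.+1) sX.
by rewrite (split n.+1 ('X * P n)) innerDr // (inner_lowr low) // addr0 XPn polyC1 mul1r.
Qed.

Lemma three_term_norms B G : three_term P B G -> forall n, G n.+1 * H n = H n.+1.
Proof.
move=> tt n; rewrite -inner_XP tt !innerDl // !innerCl //.
rewrite (@Port n.+2 n) ?gtn_eqF // ?(@Port n.+1 n) ?gtn_eqF //.
by rewrite mulr0 !add0r.
Qed.

(** The residue of X P_n after subtracting the three terms has degree at most n
    and is orthogonal to all P_k with k at most n: for k = n and k = n - 1 by the choice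
    of the coefficients, for smaller k because X P_k has degree less than n. *)
Lemma three_term_ex : exists B G, three_term P B G.
Proof.
pose B n := <|'X * P n, P n|> * (H n)^-1.
pose G n := if n is k.+1 then H k.+1 * (H k)^-1 else 0.
exists B, G => n; apply/eqP; rewrite -subr_eq0; apply/eqP.
pose prev := if n is k.+1 then P k else 0.
have sX : (size ('X * P n)%R <= n.+2)%N.
  by rewrite -commr_polyX size_mulX ?Ps // monic_neq0.
have XPn : ('X * P n)`_n.+1 = 1.
  by rewrite coefXM /= (monic_lead_coef (Pm n)).
set r := (X in X = 0).
have r_sum : r = ('X * P n - (('X * P n)`_n.+1)%:P * P n.+1)
    + (- B n)%:P * P n + (- G n)%:P * prev.
  by rewrite /r XPn polyC1 mul1r !polyCN !mulNr !opprD !addrA.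
have sr : (size r <= n.+1)%N.
  rewrite r_sum; apply: leq_trans (size_polyD _ _) _; rewrite geq_max.
  apply/andP; split.
    apply: leq_trans (size_polyD _ _) _; rewrite geq_max size_sub_lead //=.
    by apply: leq_trans (size_polyMleq _ _) _; rewrite size_polyC Ps; case: eqP.
  rewrite /prev; case: (n) => [|k]; first by rewrite mulr0 size_poly0.
  apply: leq_trans (size_polyMleq _ _) _; rewrite size_polyC Ps; case: eqP => //= _.
  by rewrite leqW.
apply: (inner_eq0 sr) => k kn.
have Nl p : <|- p, P k|> = - <|p, P k|>.
  by rewrite -mulN1r -polyC1 -polyCN innerCl // mulN1r.
rewrite r_sum XPn polyC1 mul1r !innerDl // Nl !innerCl // Port ?gtn_eqF // oppr0 addr0.
move: kn; rewrite ltnS leq_eqVlt => /orP[/eqP->|kn].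
  have -> : <|prev, P n|> = 0.
    by rewrite /prev; case: (n) => [|j]; rewrite ?inner0l // Port // ltn_eqF.
  by rewrite /B mulNr mulrVK // subrr mulr0 addr0.
rewrite [<|P n, P k|>]Port ?gtn_eqF // mulr0 addr0 /prev /G.
case: n kn {prev XPn sX r r_sum sr} => // n; rewrite ltnS leq_eqVlt => /orP[/eqP->|kn].
  by rewrite inner_XP mulNr mulrVK // subrr.
rewrite [<|P n, P k|>]Port ?gtn_eqF // mulr0 addr0 (innerX mu a_gt0).
apply: (@inner_lowr _ k.+2) => //.
by rewrite -commr_polyX size_mulX ?Ps // monic_neq0.
Qed.

Lemma orth_upto_monic n : orth_upto a mu l (evalN (P n)) n.
Proof.
move=> i ilt.
have [q sq qE] : exists2 q : {poly M}, (size q <= i.+1)%N &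
    forall x, evalN q x = ofR (ffactR R i x) *: 1.
  elim: i {ilt} => [|i [q sq qE]].
    exists 1; first by rewrite size_poly1.
    by move=> x; rewrite /evalN hornerC /ffactR ffactn0 ofR_nat scale1r.
  exists (q * ('X - (i%:R)%:P)).
    by apply: leq_trans (size_polyMleq _ _) _; rewrite size_XsubC addn2.
  move=> x; rewrite evalNM qE /evalN hornerXsubC ffactR_succ.
  rewrite /ofR (rmorphM (real_complex R)) (rmorphB (real_complex R)) /=.
  by rewrite !(rmorph_nat (real_complex R)) scalar_mul_natB.
have <- : <|P n, q|> = 0 by exact: (inner_lowr sq).
have h : series (fun x => evalN (P n) x * W x * (evalN q x) ^t*) @ \oo --> <|P n, q|>.
  exact: (inner_cvg a_gt0).
apply: (eq_series_cvg _ h) => x.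
rewrite qE linearZ /= trmx1 map_mxZ map_mx1 -scalerAr mulr1; congr (_ *: _).
by apply: conj_Creal; rewrite complex_real.
Qed.

Local Notation B s := (toC (B0R m a mu s)).

(** The coefficient of x^n in the recurrence gives B_n = X_n - X_(n+1), where
    X_(n+1) = - ((n+1) B_0(l+n) + (n+1) n / 2) by [subleading]; the binomial
    coefficients differ by n. *)
Lemma three_term_telescope Bc G : three_term P Bc G -> forall n,
  Bc n = n.+1%:R *: B (l + n) - (if n is k.+1 then n%:R *: B (l + k) else 0)
    + n%:R *: 1.
Proof.
have sub n : (P n.+1)`_n = - (n.+1%:R *: B (l + n) + 'C(n.+1, 2)%:R *: 1).
  have o : orth_upto a mu l (evalN (P n.+1)) n.+1 by exact: orth_upto_monic.
  rewrite (subleading a_gt0 muP _ o) ?Ps //.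
  by rewrite (monic_lead_coef (Pm n.+1)) // mul1r.
move=> tt n; have := congr1 (fun p : {poly M} => p`_n) (tt n).
rewrite /= coefXM !coefD !coefCM (monic_lead_coef (Pm n) (Ps n)) mulr1 sub.
case: n => [|k] /=.
  rewrite coef0 mulr0 addr0 => /esym/eqP; rewrite addrC subr_eq0 => /eqP->.
  by rewrite bin_small // !scale0r !addr0 subr0.
rewrite [(P k)`_k.+1]nth_default ?Ps // mulr0 addr0 sub => h.
have -> : Bc k.+1 = - - (k.+2%:R *: B (l + k.+1) + 'C(k.+2, 2)%:R *: 1)
    + - (k.+1%:R *: B (l + k) + 'C(k.+1, 2)%:R *: 1) by rewrite h opprK addNKr.
have cancel (b b' u v : M) : b + (u + v) - (b' + u) = b - b' + v.
  by rewrite opprD addrACA [u + v]addrC addrK.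
by rewrite binS bin1 natrD [(_ + _) *: 1]scalerDl opprK; exact: cancel.
Qed.

End OrthPoly.

(** * The recurrence coefficients *)

Lemma unitr_mul5 (B : unitRingType) (X Y Z U V : B) :
  X \is a GRing.unit -> Y \is a GRing.unit -> Z \is a GRing.unit ->
  U \is a GRing.unit -> V \is a GRing.unit -> X * Y * Z * U * V \is a GRing.unit.
Proof. by move=> Xu Yu Zu Uu Vu; rewrite !unitrMl. Qed.

Lemma ratio_of_norms (B : unitRingType) (L E D F T Y X c : B) :
  L \is a GRing.unit -> E \is a GRing.unit -> D \is a GRing.unit ->
  F \is a GRing.unit -> T \is a GRing.unit ->
  c * (L^-1 * E * D * F * T) = Y * (X * F) * T -> c = Y * X * D^-1 * E^-1 * L.
Proof.
move=> Lu Eu Du Fu Tu h.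
have Nu : L^-1 * E * D * F * T \is a GRing.unit by rewrite unitr_mul5 ?unitrV.
by apply: (mulIr Nu); rewrite h !mulrA mulrK // mulrVK // mulrVK.
Qed.

Section Main.
Variables (R : realType) (m : nat) (a : R) (mu : nat -> R).
Local Notation C := (Cplx R).
Local Notation M := 'M[C]_m.+1.
Hypothesis muP : mu_spec m a mu.
Local Notation E := (1 + Amx m mu).
Local Notation Es := (1 + (Amx m mu) ^t*).
Local Notation L := (L0mx m a mu).

Lemma posdef_unit (D : M) : posdefmx D -> D \is a GRing.unit.
Proof.
move=> [_ Dpos]; rewrite -[_ \is a _]/(D \in unitmx) unitmxE unitfE.
apply/negP => /det0P[u u0 uD].
by have := Dpos _ u0; rewrite uD mul0mx mxE ltxx.
Qed.

Lemma IA_unit : E \is a GRing.unit.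
Proof. by rewrite (IA_toC muP) toC_unit // ER_unit. Qed.

Lemma L0_unit : L \is a GRing.unit.
Proof. by rewrite L0mx_toC toC_unit // (LR_unit muP). Qed.

Lemma trC_unit (X : M) : X \is a GRing.unit -> X ^t* \is a GRing.unit.
Proof.
move=> Xu; rewrite -[_ \is a _]/(X ^t* \in unitmx) map_unitmx unitmx_tr.
exact: Xu.
Qed.

Lemma IAt_IA : Es = E ^t*.
Proof. by rewrite trCD trmx1 map_mx1. Qed.

Lemma toC_B0R s : toC (B0R m a mu s) =
  B0form (ofR a) E L^-1 L (calA m a) s.
Proof.
rewrite /B0R /B0form toCZ !toCM toCD !toCM !toCX !toCV ?ER_unit ?(LR_unit muP) //.
by rewrite -L0mx_toC -(IA_toC muP) -calA_toC.
Qed.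
End Main.

Theorem theorem6p5 (R : realType) (m : nat) (a : R) (l : nat) (mu : nat -> R)
    (P : nat -> {poly 'M[Cplx R]_m.+1}) (D : nat -> 'M[Cplx R]_m.+1) :
  let I : 'M[Cplx R]_m.+1 := 1 in
  let A := Amx m mu in
  let L0 := L0mx m a mu in
  let W := weight m a mu l in
  0 < a ->
  mu_spec m a mu ->
  monic_orthogonal W P ->
  (forall n, is_diag_mx (D n) /\ posdefmx (D n) /\
     mx_inner W (P n) (P n) =
       L0^-1 * (I + A) ^+ (n + l) * D n * (I + A ^t*) ^+ (n + l)
         * (L0 ^t*)^-1) ->
  (exists B C : nat -> 'M[Cplx R]_m.+1, three_term P B C) /\
  (forall B C : nat -> 'M[Cplx R]_m.+1, three_term P B C ->
     (forall n, (1 <= n)%N ->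
        C n = L0^-1 * (I + A) ^+ (n + l) * D n * (I + A ^t*) * (D n.-1)^-1
                * (I + A) ^ (- n%:Z - l%:Z + 1) * L0) /\
     (forall n,
        B n = ofR a *: (L0^-1 * (I + A) ^+ (n + l)
                * (n.+1%:R * (I + A) * calA m a (n + l + 1)
                   - n%:R * calA m a (n + l) * (I + A)
                   + I + A + ofR (n%:R / a) *: I)
                * (I + A) ^ (- l%:Z - n%:Z) * L0))).
Proof.
move=> I A L0 W a_gt0 muP Po HD.
have Eu : (I + A) \is a GRing.unit by exact: (IA_unit muP).
have Esu : (I + A ^t*) \is a GRing.unit by rewrite /I /A IAt_IA; exact: trC_unit.
have Lu : L0 \is a GRing.unit by exact: (L0_unit muP).
have Ltu : L0 ^t* \is a GRing.unit by exact: trC_unit.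
have Du n : D n \is a GRing.unit by have [_ [/posdef_unit]] := HD n.
have normE n := (HD n).2.2.
have Lvu : L0^-1 \is a GRing.unit by rewrite unitrV.
have Ltvu : (L0 ^t*)^-1 \is a GRing.unit by rewrite unitrV.
have Eku k : (I + A) ^+ k \is a GRing.unit := unitrX k Eu.
have Esku k : (I + A ^t*) ^+ k \is a GRing.unit := unitrX k Esu.
have Hu n : mx_inner W (P n) (P n) \is a GRing.unit.
  by rewrite normE; exact: unitr_mul5 Lvu (Eku _) (Du n) (Esku _) Ltvu.
split; first exact: (three_term_ex a_gt0 Po Hu).
move=> B C tt; split.
  case=> // n _; have := three_term_norms a_gt0 Po tt n; rewrite !normE.
  have -> : - n.+1%:Z - l%:Z + 1 = - (n + l)%:Z by lia.
  rewrite -exprnN addSn [(I + A ^t*) ^+ (n + l).+1]exprS.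
  exact: ratio_of_norms Lu (Eku _) (Du n) (Esku _) Ltvu.
move=> n; rewrite (three_term_telescope a_gt0 muP Po tt).
have -> : - l%:Z - n%:Z = - (n + l)%:Z by lia.
have a0 : ofR a != 0 by rewrite /ofR (fmorph_eq0 (real_complex R)) gt_eqF.
rewrite -exprnN addn1.
have -> : ofR (n%:R / a) = n%:R / ofR a.
  by rewrite /ofR (fmorph_div (real_complex R)) (rmorph_nat (real_complex R)).
have := B0form_combine (calA m a) Eu (mulVr Lu) a0 l n.
rewrite exprVn [in RHS]mulrA [_ - _ + (I + A)]addrA => <-.
have -> : (if n is k.+1 then n%:R *: toC (B0R m a mu (l + k)) else 0) =
    if n is k.+1 then n%:R *: B0form (ofR a) (I + A) L0^-1 L0 (calA m a) (l + k) else 0.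
  by case: (n) => [|k]; [reflexivity | rewrite -(toC_B0R muP)].
by rewrite (toC_B0R muP).
Qed.
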